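(* Let $A$ and $B$ be $F$-multiplicity-free skew shapes of size $n$. Then $s_A = s_B$ if and only if $B \in \{A, A^\circ\}$. Otherwise (i.e. if $B\notin\{A,A^\circ\}$), $s_A - s_B$ is $F$-positive (equivalently, $\mathrm{supp}_F(A) \supseteq \mathrm{supp}_F(B)$) if and only if one of the following conditions holds up to antipodal rotation of $A$ and/or $B$ (i.e. after possibly replacing $A$ by $A^\circ$ and/or $B$ by $B^\circ$): (a) $A = (1^\ell) \oplus (n-\ell)$ and $B \in \{(n-\ell, 1^\ell),\ (n-\ell+1, 1^{\ell-1})\}$ for some $1 \leq \ell \leq n-1$; (b) $A = (1^2) \oplus (n-2)$ and $B = (n-2, 2)$ with $n\geq 4$; (c) $A= (1^{n-2}) \oplus (2)$ and $B = (2,2, 1^{n-4})$ with $n\geq 4$.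
   Context: A composition of $n$ is a sequence of positive integers with sum $n$; a partition is a weakly decreasing composition. Compositions $\alpha=(\alpha_1,\dots,\alpha_k)$ of $n$ correspond bijectively to subsets of $[n-1]=\{1,\dots,n-1\}$ via $S(\alpha)=\{\alpha_1,\alpha_1+\alpha_2,\dots,\alpha_1+\cdots+\alpha_{k-1}\}$. Young diagrams are left-justified with row $1$ at the top; a skew shape $\lambda/\mu$ is the Young diagram of $\lambda$ with the boxes of $\mu\subseteq\lambda$ removed from its top-left. A partition $\lambda$ is identified with the skew shape $\lambda/\emptyset$. The size of a skew shape is its number of boxes. Skew shapes are identified when they differ only by empty rows or empty columns (in particular, by translation). A standard Young tableau (SYT) of a skew shape $A$ with $n$ boxes is a filling of the boxes by $1,\dots,n$, each used once, increasing left to right along rows and down columns. Its descent set is the set of $i$ such that $i+1$ appears in a strictly lower row than $i$, and its descent composition is the composition of $n$ corresponding to its descent set. The monomial quasisymmetric functions are $M_\alpha=\sum_{i_1<\cdots<i_k}x_{i_1}^{\alpha_1}\cdots x_{i_k}^{\alpha_k}$, and the fundamental quasisymmetric functions are $F_\alpha=\sum_{S(\alpha)\subseteq S(\beta)\subseteq[n-1]}M_\beta$ for $\alpha$ of size $n$; they form a basis of the quasisymmetric functions. The skew Schur function is $s_A=\sum_T F_{\mathrm{comp}(T)}$, the sum being over all SYT $T$ of shape $A$, where $\mathrm{comp}(T)$ is the descent composition of $T$. The $F$-support $\mathrm{supp}_F(A)$ is the set of compositions $\alpha$ such that $F_\alpha$ has positive coefficient in $s_A$. A quasisymmetric function is $F$-positive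 if all its coefficients in the $F$-basis are nonnegative. A skew shape $A$ is $F$-multiplicity-free if all coefficients in the $F$-expansion of $s_A$ are $0$ or $1$ (equivalently, all SYT of shape $A$ have distinct descent sets). $A^\circ$ denotes the antipodal rotation of $A$, i.e. $A$ rotated by $180^\circ$. $1^\ell$ denotes a sequence of $\ell$ copies of $1$. $A\oplus B$ denotes the skew shape obtained by placing $A$ immediately below and to the left of $B$ so that $A$ and $B$ have no rows or columns in common; e.g. $(1^2)\oplus(2)=311/1$. *)

(* Defs.v *)
From HB Require Import structures.
From mathcomp Require Import all_boot all_order all_algebra.
From mathcomp Require Import finmap.

Set Implicit Arguments.
Unset Strict Implicit.
Unset Printing Implicit Defensive.

Import GRing.Theory.

Local Open Scope fset_scope.
Local Open Scope nat_scope.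

Definition is_composition (a : seq nat) : bool := all (fun x => 0 < x) a.

Definition is_partition (a : seq nat) : bool := is_composition a && sorted geq a.

(* The compositions of n.+1 are the compositions of n with either a new part 1
   in front, or the first part increased by 1 (see [mem_compositions]). *)
Fixpoint compositions (n : nat) : seq (seq nat) :=
  if n is n'.+1 then
    [seq 1 :: a | a <- compositions n'] ++
    [seq (head 0 a).+1 :: behead a | a <- compositions n' & a != [::]]
  else [:: [::]].

Definition comp_set (a : seq nat) : seq nat :=
  [seq sumn (take i a) | i <- iota 1 (size a).-1].

(* The inverse of [comp_set] (see [comp_of_setK]): D is an increasing list of
   elements of {1, ..., n - 1}. *)
Definition comp_of_set (n : nat) (D : seq nat) : seq nat :=
  if n is 0 then [::] else pairmap (fun x y => y - x) 0 (rcons D n).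

Lemma mem_compositions n a :
  (a \in compositions n) = is_composition a && (sumn a == n).
Proof.
elim: n a => [|n IHn] a /=.
  by case: a => [|[|x] a] //=; rewrite in_cons in_nil orbF -?addnE ?andbF.
rewrite mem_cat; apply/orP/andP.
  case=> /mapP[b]; first by rewrite IHn => /andP[pb /eqP <-] ->; split.
  rewrite mem_filter IHn => /andP[nb /andP[pb /eqP <-]] ->.
  by case: b nb pb => //= x b _ /andP[_ pb]; split=> //=.
case: a => [|[|[|x]] a] [] //= pa /eqP[sa].
  by left; apply: map_f; rewrite IHn pa -sa /=.
right; apply/mapP; exists (x.+1 :: a) => //.
by rewrite mem_filter IHn /= pa -sa /=.
Qed.

Lemma uniq_compositions n : uniq (compositions n).
Proof.
elim: n => //= n IHn; rewrite cat_uniq map_inj_uniq => [|? ? []] //.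
rewrite IHn /=; apply/andP; split.
  apply/hasPn => x /mapP[b]; rewrite mem_filter => /andP[nb].
  rewrite mem_compositions => /andP[pb _] ->; apply/mapP=> [[c _]].
  by case: b nb pb => //= [[|y] b].
rewrite map_inj_in_uniq ?filter_uniq // => b c.
rewrite !mem_filter => /andP[nb _] /andP[nc _].
by case: b c nb nc => [|x b] [|y c] //= _ _ [-> ->].
Qed.

Lemma comp_of_setP n D : path ltn 0 (rcons D n) ->
  comp_of_set n D \in compositions n.
Proof.
case: n => [|n] pD.
  by have := order_path_min ltn_trans pD; rewrite all_rcons.
rewrite mem_compositions /comp_of_set; apply/andP; split.
  by elim: (rcons D _) 0 pD => //= y s IH x /andP[ltxy /IH]; rewrite subn_gt0 ltxy.
suff: 0 + sumn (pairmap (fun x y => y - x) 0 (rcons D n.+1)) = n.+1 by rewrite add0n => ->.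
rewrite -[RHS](last_rcons 0 D n.+1); elim: (rcons D _) 0 pD => [|y s IH] x /=.
  by rewrite addn0.
by case/andP=> ltxy /IH <-; rewrite addnA subnKC // ltnW.
Qed.

Lemma comp_of_setK n D : path ltn 0 (rcons D n) -> comp_set (comp_of_set n D) = D.
Proof.
case: n => [|n] pD.
  by have := order_path_min ltn_trans pD; rewrite all_rcons.
rewrite /comp_set /comp_of_set size_pairmap size_rcons /=.
apply: (@eq_from_nth _ 0); rewrite size_map size_iota // => i ltiD.
rewrite (nth_map 0) ?size_iota // nth_iota // add1n.
have ->: nth 0 D i = nth 0 (rcons D n.+1) i by rewrite nth_rcons ltiD.
have {ltiD}: i < size (rcons D n.+1) by rewrite size_rcons ltnW.
suff H x s : path ltn x s -> i < size s ->
    x + sumn (take i.+1 (pairmap (fun x y => y - x) x s)) = nth 0 s i.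
  by move=> /(H _ _ pD).
elim: s x i {pD} => //= y s IH x [|i] /andP[ltxy ps].
  by rewrite take0 /= addn0 subnKC // ltnW.
by move=> lti /=; rewrite addnA subnKC ?IH // ltnW.
Qed.

(* The variables x_0, x_1, ... are indexed by nat. *)
Definition monomial := {fsfun nat -> nat with 0}.

(* Formal power series with integer coefficients (of possibly infinite support). *)
Definition series := monomial -> int.

Definition exponents (m : monomial) : seq nat :=
  [seq m i | i <- sort leq (finsupp m)].

(* A monomial equals x_{i_1}^{a_1} ... x_{i_k}^{a_k} with i_1 < ... < i_k for
   at most one choice of the indices, its support; so its coefficient in M_a
   is 1 or 0 (see [exponentsP]). *)
Definition qsym_M (a : seq nat) : series := fun m => ((exponents m == a)%:R)%R.

Lemma exponentsP (a : seq nat) (m : monomial) : is_composition a ->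
  reflect (exists s : seq nat, [/\ size s = size a, sorted ltn s &
             forall i, m i = nth 0 a (index i s)])
          (exponents m == a).
Proof.
move=> /allP pa; apply: (iffP eqP) => [<- | [s [ss lts ms]]].
  exists (sort leq (finsupp m)); split; first by rewrite size_map.
    rewrite ltn_sorted_uniq_leq sort_uniq fset_uniq /=.
    by apply: sort_sorted; apply: leq_total.
  move=> i; have [im|im] := boolP (i \in finsupp m).
    rewrite (nth_map 0) ?nth_index ?index_mem ?mem_sort //.
  rewrite fsfun_dflt // nth_default // size_map.
  by rewrite memNindex ?mem_sort.
rewrite /exponents; have ->: sort leq (finsupp m) = s.
  have us : uniq s by apply: (sorted_uniq ltn_trans ltnn).
  apply: (sorted_eq leq_trans anti_leq).
  - by apply: sort_sorted; apply: leq_total.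
  - by move: lts; rewrite ltn_sorted_uniq_leq => /andP[].
  rewrite perm_sort; apply: uniq_perm; rewrite ?fset_uniq // => i.
  rewrite mem_finsupp ms; have [im|im] := boolP (i \in s).
    by rewrite -lt0n; apply/pa/mem_nth; rewrite -ss index_mem.
  by rewrite memNindex // nth_default ?ss ?eqxx.
have us : uniq s by apply: (sorted_uniq ltn_trans ltnn).
apply: (@eq_from_nth _ 0); rewrite size_map // => i lti.
by rewrite (nth_map 0) // ms index_uniq.
Qed.

Definition qsym_F (a : seq nat) : series := fun m =>
  (\sum_(b <- compositions (sumn a) | all (mem (comp_set b)) (comp_set a))
     qsym_M b m)%R.

(* As the F_a form a basis of the quasisymmetric functions, c is unique. *)
Definition F_expansion (f : series) (c : {fsfun seq nat -> int with 0%R}) : Prop :=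
  all is_composition (finsupp c) /\
  forall m, f m = (\sum_(a <- finsupp c) c a * qsym_F a m)%R.

Definition F_positive (f : series) : Prop :=
  exists2 c, F_expansion f c & forall a, (0 <= c a)%R.

(* Box (i, j) lies in row i and column j, both counted from 0, with row 0 at
   the top. *)
Definition diagram := {fset nat * nat}.

Definition young (la : seq nat) : diagram :=
  [fset b in [seq (i, j) | i <- iota 0 (size la), j <- iota 0 (nth 0 la i)]].

Definition is_skew_shape (A : diagram) : Prop :=
  exists la mu : seq nat,
    [/\ is_partition la, is_partition mu, young mu `<=` young la
      & A = young la `\` young mu].

Definition rows (A : diagram) : {fset nat} := [fset b.1 | b in A].
Definition cols (A : diagram) : {fset nat} := [fset b.2 | b in A].

(* A with its empty rows and empty columns deleted. *)
Definition compress (A : diagram) : diagram :=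
  [fset (#|` [fset i in rows A | i < b.1]|, #|` [fset j in cols A | j < b.2]|)
   | b in A].

(* Identification of diagrams differing only by empty rows or columns. *)
Definition same_shape (A B : diagram) : Prop := compress A = compress B.

Definition height (A : diagram) : nat := \max_(i <- rows A) i.+1.
Definition width (A : diagram) : nat := \max_(j <- cols A) j.+1.

Definition antipode (A : diagram) : diagram :=
  [fset (height A - b.1.+1, width A - b.2.+1) | b in A].

(* A placed immediately below and to the left of B. *)
Definition dsum (A B : diagram) : diagram :=
  [fset (height B + b.1, b.2) | b in A] `|` [fset (b.1, width A + b.2) | b in B].

Definition filling (A : diagram) := {ffun A -> 'I_(#|` A|).+1}.

Definition is_SYT (A : diagram) (T : filling A) : bool :=
  [&& injectiveb T, [forall b, 0 < T b],
      [forall b, forall b', ((val b).1 == (val b').1) && ((val b).2 < (val b').2)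
                            ==> (T b < T b')]
    & [forall b, forall b', ((val b).2 == (val b').2) && ((val b).1 < (val b').1)
                            ==> (T b < T b')]].

Definition is_descent (A : diagram) (T : filling A) (i : nat) : bool :=
  [exists b, exists b',
    [&& T b == i :> nat, T b' == i.+1 :> nat & (val b).1 < (val b').1]].

Definition descent_set (A : diagram) (T : filling A) : seq nat :=
  [seq i <- iota 1 (#|` A|).-1 | is_descent T i].

Definition descent_comp (A : diagram) (T : filling A) : seq nat :=
  comp_of_set #|` A| (descent_set T).

Definition schur (A : diagram) : series := fun m =>
  (\sum_(T : filling A | is_SYT T) qsym_F (descent_comp T) m)%R.

Definition supp_F (A : diagram) (a : seq nat) : Prop :=
  exists2 c, F_expansion (schur A) c & (0 < c a)%R.

Definition F_multiplicity_free (A : diagram) : Prop :=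
  exists2 c, F_expansion (schur A) c & forall a, c a = 0%R \/ c a = 1%R.

Definition cond_a (n : nat) (A B : diagram) : Prop :=
  exists l, [/\ 1 <= l <= n - 1,
    same_shape A (dsum (young (nseq l 1)) (young [:: n - l])) &
    same_shape B (young (n - l :: nseq l 1)) \/
    same_shape B (young (n - l + 1 :: nseq (l - 1) 1))].

Definition cond_b (n : nat) (A B : diagram) : Prop :=
  [/\ 4 <= n,
    same_shape A (dsum (young (nseq 2 1)) (young [:: n - 2])) &
    same_shape B (young [:: n - 2; 2])].

Definition cond_c (n : nat) (A B : diagram) : Prop :=
  [/\ 4 <= n,
    same_shape A (dsum (young (nseq (n - 2) 1)) (young [:: 2])) &
    same_shape B (young [:: 2, 2 & nseq (n - 4) 1])].

(* Main.v *)
(* Standard Young tableaux of A are the linear extensions of the box poset of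
   A, and the descent composition records the word of descents between
   consecutive boxes. As the F_a are linearly independent, a shape is
   F-multiplicity-free exactly when its linear extensions have distinct descent
   words, and the statement compares sets of descent words.

   Classification. If three boxes form an antichain, choose one of minimal total
   weight: reordering these three boxes (and possibly what precedes them) in two
   ways produces the same descent word. So a multiplicity-free shape has width at
   most two. With at least three rows and columns it therefore lies on the border
   of its bounding box, and is a hook or (1^l) (+) (n-l) up to rotation. Two-row
   shapes are excluded by explicit pairs of ballot words, except for (n-1,1),
   (n-2,2), (3,3), (4,4), (1) (+) (n-1) up to rotation; two-column shapes follow
   by transposition, which complements descent words.

   Comparison. The words of the hook (n-l,1^l) are those with l descents, those
   of (1^l) (+) (n-l) have l or l-1 descents, and those of (n-2,2) have one or
   two. The number of descents, together with the absence of words consisting of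
   descents followed by ascents for all shapes other than hooks and
   (1^l) (+) (n-l), settles all containments. All these sets are closed under
   reversal, that is under rotation of the shape. *)

Require Import Defs.
From HB Require Import structures.
From mathcomp Require Import all_boot all_order all_algebra.
From mathcomp Require Import finmap zify.

Set Implicit Arguments.
Unset Strict Implicit.
Unset Printing Implicit Defensive.

Import GRing.Theory.

Local Open Scope fset_scope.
Local Open Scope nat_scope.


(** * Linear extensions and descent words *)

(** Skew shapes enter only through convexity for the box order. Convexity survives transposition,
    rotation and the deletion of empty rows and columns, and it suffices both for the corner
    arguments and for the passage from tableaux to linear extensions.

    Minimal weight matters because it forces everything below the three boxes of an antichain under
    at most two corner boxes, so that a linear extension can reach the antichain through a
    controlled ideal. The box that follows is not under control; two rival exchanges are kept in
    hand, and whichever row that box lies in, one of them preserves the descent into it.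

    A convex diagram without empty rows and columns contains its north-east and south-west corners.
    These form an antichain with any box strictly inside the bounding box, which is how width two
    confines a shape to the border.

    The decisive fact on supports is that (1^l) (+) (n-l) realises every word with l or l-1
    descents: containment in it is a matter of counting, and no other shape on the list properly
    contains another one. The 2 x 3 and 2 x 4 rectangles follow no such pattern and are
    enumerated. *)

Definition box_le (x y : nat * nat) : bool := (x.1 <= y.1) && (x.2 <= y.2).

Definition descends (x y : nat * nat) : bool := x.1 < y.1.

(** Negating the reverse relation leaves incomparable boxes free, and it also excludes repetitions
    because [box_le] is reflexive. *)
Definition ordered (l : seq (nat * nat)) : bool :=
  pairwise (fun x y => ~~ box_le y x) l.

Definition lin_ext (A : diagram) (l : seq (nat * nat)) : Prop :=
  l =i A /\ ordered l.

Definition des (l : seq (nat * nat)) : seq bool :=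
  pairmap descends (head (0, 0) l) (behead l).

Definition convex (A : diagram) : Prop :=
  forall x y z, x \in A -> y \in A -> box_le x z -> box_le z y -> z \in A.

Definition des_free (A : diagram) : Prop :=
  forall l l', lin_ext A l -> lin_ext A l' -> des l = des l' -> l = l'.

Definition has_des (A : diagram) (w : seq bool) : Prop :=
  exists2 l, lin_ext A l & des l = w.

Lemma box_lexx x : box_le x x. Proof. by rewrite /box_le !leqnn. Qed.

Lemma box_le_trans y x z : box_le x y -> box_le y z -> box_le x z.
Proof. by rewrite /box_le => /andP[? ?] /andP[? ?]; apply/andP; split; lia. Qed.

Lemma box_le_anti x y : box_le x y -> box_le y x -> x = y.
Proof.
by case: x y => [a b] [c d] /andP[/= ? ?] /andP[/= ? ?]; congr pair; lia.
Qed.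

Lemma ordered_uniq l : ordered l -> uniq l.
Proof.
elim: l => //= x l IHl; rewrite /ordered /= => /andP[/allP hx /IHl ->].
by rewrite andbT; apply/negP => /hx; rewrite box_lexx.
Qed.

Lemma ordered_cat s t :
  ordered (s ++ t) =
  [&& ordered s, ordered t & allrel (fun x y => ~~ box_le y x) s t].
Proof. by rewrite /ordered pairwise_cat andbC -andbA. Qed.

Lemma des_cat l x y l' :
  des (rcons l x ++ y :: l') = des (rcons l x) ++ descends x y :: des (y :: l').
Proof.
case: l => [|z l] //=; rewrite /des /= pairmap_cat /= last_rcons.
by [].
Qed.

Lemma size_des l : size (des l) = (size l).-1.
Proof. by rewrite /des size_pairmap size_behead. Qed.

(** A descent word consists of the words of the blocks and one letter at each junction; a junction
    is constrained only where a neighbour exists. *)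
Lemma des_exchange u p q v : size p = size q -> des p = des q ->
  (u != [::] -> descends (last (0, 0) u) (head (0, 0) p) =
                descends (last (0, 0) u) (head (0, 0) q)) ->
  (v != [::] -> descends (last (0, 0) p) (head (0, 0) v) =
                descends (last (0, 0) q) (head (0, 0) v)) ->
  des (u ++ p ++ v) = des (u ++ q ++ v).
Proof.
move=> spq dpq hu hv.
case: (eqVneq p [::]) => [p0|p0].
  by move: spq; rewrite p0; case: (q).
have q0 : q != [::] by rewrite -size_eq0 -spq size_eq0.
have {hv dpq}: des (p ++ v) = des (q ++ v).
  case: v hv => [|b v] hv; first by rewrite !cats0.
  have [x [p' Ep]] : exists x p', p = rcons p' x by case/lastP: (p) p0 => // s z; exists z, s.
  have [y [q' Eq]] : exists x q', q = rcons q' x by case/lastP: (q) q0 => // s z; exists z, s.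
  by subst p q; rewrite !des_cat dpq; move: (hv isT); rewrite !last_rcons /= => ->.
case/lastP: u hu => [|u a] //= hu E.
case: p q p0 q0 hu E {spq} => [|x p] [|y q] // _ _ hu E.
rewrite !cat_cons !des_cat -!cat_cons E; congr (_ ++ _ :: _).
by move: hu; rewrite last_rcons /= => ->; case: (u).
Qed.

(** Comparisons between the block and the rest depend only on the set of boxes in the block, so only
    the order inside the new block has to be checked. *)
Lemma lin_ext_exchange A u p q v : lin_ext A (u ++ p ++ v) ->
  perm_eq p q -> ordered q -> lin_ext A (u ++ q ++ v).
Proof.
move=> [memA ordA] pq oq; split=> [x|].
  by rewrite -memA !mem_cat (perm_mem pq).
have allrelE (r : rel (nat * nat)) s t s' t' : s =i s' -> t =i t' ->
    allrel r s t -> allrel r s' t'.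
  by move=> es et /allrelP h; apply/allrelP=> x y; rewrite -es -et; apply: h.
move: ordA; rewrite !ordered_cat oq => /and3P[-> /and3P[_ -> h1] h2] /=.
apply/andP; split; first exact: allrelE (perm_mem pq) _ h1.
by apply: allrelE h2 => // x; rewrite !mem_cat (perm_mem pq).
Qed.

Lemma des_free_exchange A u p q v : des_free A -> lin_ext A (u ++ p ++ v) ->
  perm_eq p q -> ordered q -> des p = des q ->
  (u != [::] -> descends (last (0, 0) u) (head (0, 0) p) =
                descends (last (0, 0) u) (head (0, 0) q)) ->
  (v != [::] -> descends (last (0, 0) p) (head (0, 0) v) =
                descends (last (0, 0) q) (head (0, 0) v)) ->
  p = q.
Proof.
move=> mfA lA pq oq dpq hu hv.
have E := des_exchange (perm_size pq) dpq hu hv.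
have /eqP := mfA _ _ lA (lin_ext_exchange lA pq oq) E.
by rewrite eqseq_cat // eqxx /= eqseq_cat ?(perm_size pq) // => /andP[/eqP].
Qed.

(** Sorting by i + j works because this sum increases strictly along the box order. *)
Lemma ordered_exists (s : seq (nat * nat)) : uniq s ->
  exists2 l, perm_eq l s & ordered l.
Proof.
move=> us; pose r := [rel x y : nat * nat | x.1 + x.2 <= y.1 + y.2].
have rtr : transitive r by move=> y x z; apply: leq_trans.
have rto : total r by move=> x y; apply: leq_total.
exists (sort r s); first by rewrite perm_sort.
have: uniq (sort r s) by rewrite sort_uniq.
have: pairwise r (sort r s) by rewrite -sorted_pairwise ?sort_sorted.
rewrite /ordered; elim: (sort r s) => //= x l IHl.
move=> /andP[/allP hx pl] /andP[xl ul]; rewrite IHl // andbT.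
apply/allP => y yl; apply/negP => /andP[h1 h2]; have /= h3 := hx _ yl.
suff exy : y = x by rewrite -exy yl in xl.
by case: x y h1 h2 h3 {hx xl yl} => [a b] [c d] /= *; congr pair; lia.
Qed.

(** * No antichain of three boxes *)

Definition swap (x : nat * nat) : nat * nat := (x.2, x.1).

Definition transpose (A : diagram) : diagram := [fset swap x | x in A].

Lemma swapK : involutive swap. Proof. by case. Qed.

Lemma box_le_swap x y : box_le (swap x) (swap y) = box_le x y.
Proof. by rewrite /box_le andbC. Qed.

Lemma mem_transpose A (x : nat * nat) : (x \in transpose A) = (swap x \in A).
Proof.
apply/imfsetP/idP => [[y yA ->]|xA]; first by rewrite swapK.
by exists (swap x); rewrite ?swapK.
Qed.

Lemma transposeK : involutive transpose.
Proof. by move=> A; apply/fsetP => x; rewrite !mem_transpose swapK. Qed.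

Lemma convex_transpose A : convex A -> convex (transpose A).
Proof.
move=> cA x y z; rewrite !mem_transpose -(box_le_swap x) -(box_le_swap z).
exact: cA.
Qed.

Lemma lin_ext_transpose A l : lin_ext A l -> lin_ext (transpose A) (map swap l).
Proof.
move=> [memA ordA]; split=> [x|].
  by rewrite mem_transpose -memA -{1}(swapK x) mem_map //; apply: inv_inj swapK.
rewrite /ordered pairwise_map; apply: sub_pairwise ordA => x y /=.
by rewrite box_le_swap.
Qed.

(* Between two consecutive boxes of a linear extension of a convex diagram
   there is no room for a third one. *)
Lemma des_transpose A l : convex A -> lin_ext A l ->
  des (map swap l) = map negb (des l).
Proof.
move=> cA [memA ordA].
suff H l2 l1 : l = l1 ++ l2 -> des (map swap l2) = map negb (des l2) by apply: (H l [::]).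
elim: l2 l1 => [|x [|y l2] IHl] l1 //= El.
have /IHl : l = rcons l1 x ++ y :: l2 by rewrite cat_rcons.
rewrite /des /= => ->; congr (_ :: _).
have xl : x \in l by rewrite El mem_cat inE eqxx orbT.
have yl : y \in l by rewrite El mem_cat !inE eqxx !orbT.
move: (ordA); rewrite El ordered_cat => /and3P[_].
rewrite {1}/ordered /= => /andP[/andP[nyx _] /andP[/allP ny _]] /allrelP n1.
have Hz z : z \in A -> box_le x z -> box_le z y -> (z == x) || (z == y).
  rewrite -memA El mem_cat !inE => /or4P[zl1|->|->|zl2] //; rewrite ?orbT //.
    by have /negbTE-> := n1 z x zl1 (mem_head _ _).
  by move=> _; have /negbTE-> := ny z zl2.
(* If x <= y, the corner (x.1, y.2) lies between them, hence is one of them, and x and y share a row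
   or a column. If they are incomparable, exactly one of the two coordinates increases. Either way
   exactly one of the two steps, original or transposed, descends. *)
have := Hz (x.1, y.2); rewrite -!memA in Hz *.
move: nyx (cA x y (x.1, y.2)); rewrite -!memA xl yl /descends /box_le /=.
case: x y {El xl yl ny n1 Hz IHl} => [a b] [c d] /=; rewrite !xpair_eqE !leqnn /=.
by move=> h1 h2 h3; move: (h2 isT isT) h3; case: (_ \in l) => /= *; lia.
Qed.

Lemma des_free_transpose A : convex A -> des_free A -> des_free (transpose A).
Proof.
move=> cA mfA l l' /[dup] Ll /lin_ext_transpose; rewrite transposeK => Ll1.
move=> /[dup] Ll' /lin_ext_transpose; rewrite transposeK => Ll1' E.
have cA' := convex_transpose cA.
apply: (inj_map (inv_inj swapK)); apply: mfA => //.
by rewrite (des_transpose cA' Ll) (des_transpose cA' Ll') E.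
Qed.

Lemma lin_ext_extend (A : diagram) (s : seq (nat * nat)) :
    ordered s -> {subset s <= A} ->
    (forall x z, x \in s -> z \in A -> box_le z x -> z \in s) ->
  exists v, lin_ext A (s ++ v).
Proof.
move=> os sA cs; have [|v pv ov] := @ordered_exists [seq z <- A | z \notin s].
  by rewrite filter_uniq // fset_uniq.
exists v; split=> [x|].
  rewrite mem_cat (perm_mem pv) mem_filter.
  by case: (boolP (x \in s)) => //= /sA ->.
rewrite ordered_cat os ov; apply/allrelP => x y xs.
by rewrite (perm_mem pv) mem_filter => /andP[ys yA]; apply: contra ys; apply: cs xs yA.
Qed.

Lemma ordered_ideal (A : diagram) (P : pred (nat * nat)) :
  exists2 u, ordered u & forall x, (x \in u) = (x \in A) && P x.
Proof.
have [|u pu ou] := @ordered_exists [seq z <- A | P z].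
  by rewrite filter_uniq // fset_uniq.
by exists u => // x; rewrite (perm_mem pu) mem_filter andbC.
Qed.

Definition antichain3 (A : diagram) (x1 x2 x3 : nat * nat) : Prop :=
  [/\ x1 \in A, x2 \in A, x3 \in A,
      (x3.1 < x2.1 < x1.1) & (x1.2 < x2.2 < x3.2)].

Ltac nat_lia := repeat match goal with
  | H : ?T |- _ => lazymatch T with
      | is_true (_ <= _) => fail
      | is_true (~~ (_ && _)) => fail
      | is_true (~~ (_ == _ :> nat)) => fail
      | is_true (_ && _) => fail
      | _ = _ => fail
      | _ => clear H
      end
  end; lia.

Ltac box_lia := repeat match goal with
  | H : is_true (box_le _ _) |- _ => rewrite /box_le /= in H
  end; rewrite ?/box_le /=; nat_lia.

Ltac perm_tac :=
  by apply/permP => ?; do ?rewrite ?count_cat /=; clear; lia.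

(* With x1 = (r1, c1), etc., a = (r3, c2) and b the box following the block, both
   a x2 x3 x1 <-> a x1 x3 x2 and x1 a x2 x3 <-> a x3 x1 x2 preserve the descents
   inside the block; the first fails at its end only if r2 < b.1 <= r1, the
   second only if r3 < b.1 <= r2. As x1 is minimal in A, the second one can be
   stretched over the boxes of row r3 preceding a. *)
Lemma no_antichain3_corner A r1 r2 r3 c1 c2 c3 : convex A -> des_free A ->
  antichain3 A (r1, c1) (r2, c2) (r3, c3) -> (r3, c2) \in A ->
  (forall z, z \in A -> box_le z (r1, c1) -> z = (r1, c1)) ->
  (forall z, z \in A -> box_le z (r2, c2) -> z = (r2, c2) \/ box_le z (r3, c2)) ->
  (forall z, z \in A -> box_le z (r3, c3) -> z = (r3, c3) \/ box_le z (r3, c2)) ->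
  False.
Proof.
move=> cA mfA [x1A x2A x3A /= /andP[r32 r21] /andP[c12 c23]] aA h1 h2 h3.
set x1 := (r1, c1) in x1A h1; set x2 := (r2, c2) in x2A h2.
set x3 := (r3, c3) in x3A h3; set a := (r3, c2) in aA h2 h3.
have [u ou mu] := ordered_ideal A (fun z => box_le z a && (z != a)).
have ua z : z \in u -> [/\ z \in A, box_le z a & z <> a].
  by rewrite mu => /and3P[-> -> /eqP].
have au z : z \in A -> box_le z a -> z = a \/ z \in u.
  by move=> zA za; case: (eqVneq z a) => [|nz]; [left | right; rewrite mu zA za nz].
have nu z : z \in u -> ~~ box_le a z /\ ~~ box_le x1 z.
  move=> /ua[zA za nza]; split.
    by apply/negP => az; apply: nza; apply: box_le_anti.
  by apply/negP => xz; have := box_le_trans xz za; rewrite /a /x1; box_lia.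
have nu1 z : z \in u -> ~~ box_le z x1.
  move=> zu; apply/negP => /h1; have [zA za _] := ua z zu => /(_ zA) zx.
  by have [_] := nu z zu; rewrite zx box_lexx.
have nux z : z \in u -> ~~ box_le x2 z /\ ~~ box_le x3 z.
  move=> /ua[_ za _]; split; apply/negP => xz; have := box_le_trans xz za;
  rewrite /a /x2 /x3; box_lia.
have ord p : ordered p -> {subset p <= [:: x1; x2; x3; a]} -> ordered (u ++ p).
  move=> op sp; rewrite ordered_cat ou op; apply/allrelP => x y xu /sp.
  have [? ?] := nu x xu; have [? ?] := nux x xu.
  by rewrite !inE => /or4P[] /eqP->.
have ext w : w =i u ++ [:: a; x2; x3; x1] -> ordered w ->
    exists v, lin_ext A (w ++ v).
  move=> mw ow; apply: lin_ext_extend => // [x|x z].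
    by rewrite mw mem_cat !inE => /or3P[/ua[]|/eqP->|/or3P[]/eqP->].
  rewrite !mw !mem_cat !inE => + zA.
  have az : box_le z a -> [|| z \in u, z == a | [|| z == x2, z == x3 | z == x1]].
    by move=> /(au z zA)[->|->] //; rewrite eqxx orbT.
  move=> /or3P[/ua[_ xa _] zx | /eqP-> // | /or3P[]/eqP->].
  - by apply: az; apply: box_le_trans xa.
  - by move=> /h2[] // ->; rewrite eqxx !orbT.
  - by move=> /h3[] // ->; rewrite eqxx !orbT.
  by move=> /h1->; rewrite // eqxx !orbT.
have [|v [mv ov]] := ext (u ++ [:: a; x2; x3; x1]) (fun=> erefl).
  apply: ord => [|x]; first by rewrite /ordered /= /a /x1 /x2 /x3; box_lia.
  by rewrite !inE => /or4P[]->; rewrite ?orbT.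
(* For empty [v] the default row 0 makes the next test fail, and the exchange used then has no
   condition to meet at its end. *)
pose b := head (0, 0) v.
case: (boolP (r2 < b.1 <= r1)) => [hb|nb]; last first.
  suff: [:: a; x2; x3; x1] = [:: a; x1; x3; x2] by case=> _; rewrite /x1 /x2; nat_lia.
  apply: (@des_free_exchange A u _ _ v mfA).
  - by rewrite catA.
  - perm_tac.
  - by rewrite /ordered /= /a /x1 /x2 /x3; box_lia.
  - by rewrite /des /= /descends /a /x1 /x2 /x3 /=; do !congr (_ :: _); nat_lia.
  - by [].
  by move=> _; rewrite /descends /= -/b /x1 /x2 /=; nat_lia.
have LE p : perm_eq (u ++ [:: a; x2; x3; x1]) p -> ordered p -> lin_ext A (p ++ v).
  by move=> pp op; apply: (@lin_ext_exchange A [::] (u ++ [:: a; x2; x3; x1])).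
have px : perm_eq [:: a; x2; x3; x1] [:: x1; a; x2; x3].
  perm_tac.
have bx : descends x3 b = descends x2 b by rewrite /descends /x3 /x2 /=; nat_lia.
case: (boolP (all (fun z => z.1 == r3) u)) => [/allP hu | /allPn[e eu ne]].
  have dR l x : r3 <= x.1 -> {in l, forall z, z.1 == r3} ->
      pairmap descends x l = nseq (size l) false.
    elim: l x => //= y l IHl x hx hl; rewrite /descends.
    rewrite (eqP (hl y _)) ?mem_head // ltnNge hx /= IHl //.
      by rewrite (eqP (hl y _)) ?mem_head.
    by move=> z zl; apply: hl; rewrite inE zl orbT.
  have [R ER] : exists R, R = u ++ [:: a] by exists (u ++ [:: a]).
  have hR : {in R, forall z, z.1 == r3}.
    by move=> z; rewrite ER mem_cat inE => /orP[/hu|/eqP->].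
  suff /(congr1 (head (0, 0))): x1 :: R ++ [:: x2; x3] = R ++ [:: x3; x1; x2].
    have /= := hR (head (0, 0) R); rewrite ER; case: (u) => [|h u'] /= h0 [].
      by rewrite /x1 /a => ?; nat_lia.
    by move=> E; have := h0 (mem_head _ _); rewrite -E /x1 /= => /eqP; nat_lia.
  have E0 : perm_eq (u ++ [:: a; x2; x3; x1]) (x1 :: R ++ [:: x2; x3]).
    rewrite ER; perm_tac.
  have E1 : perm_eq (x1 :: R ++ [:: x2; x3]) (R ++ [:: x3; x1; x2]).
    perm_tac.
  apply: (@des_free_exchange A [::] _ _ v mfA) => //.
  - apply: LE => //; rewrite /ordered /=; apply/andP; split; last first.
      rewrite ER -catA; apply: ord; last first.
        by move=> z; rewrite !inE => /or3P[]->; rewrite ?orbT.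
      by rewrite /ordered /= /a /x2 /x3; box_lia.
    apply/allP => z; rewrite ER mem_cat mem_cat !inE -orbA.
    move=> /or4P[/nu1 // | /eqP-> | /eqP-> | /eqP->]; rewrite /x1 /a /x2 /x3; box_lia.
  - rewrite ER -catA; apply: ord; last first.
      by move=> z; rewrite !inE => /or4P[]->; rewrite ?orbT.
    by rewrite /ordered /= /a /x1 /x2 /x3; box_lia.
  - have dE t : des (R ++ t) = behead (pairmap descends x1 (R ++ t)).
      by rewrite ER; case: (u).
    rewrite dE {1}/des /= !pairmap_cat !(dR R x1) //=; try by rewrite /x1 /=; nat_lia.
    have -> : last x1 R = a by rewrite ER last_cat.
    rewrite ER size_cat addn1 /= /descends /=.
    have -> : (r3 < r2) = true by nat_lia. have -> : (r2 < r3) = false by nat_lia.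
    have -> : (r3 < r3) = false by nat_lia. have -> : (r3 < r1) = true by nat_lia.
    have -> : (r1 < r2) = false by nat_lia.
    by elim: (size u) => //= k ->.
  by move=> _; rewrite /= ER -catA !last_cat.
have [eA /andP[er ec] nea] := ua e eu.
rewrite /a /= in er ec ne.
(* Some box of [u] lies above row r3, so by convexity the box f directly above a belongs to A. It is
   maximal in [u]; once [u] is rearranged to end with f, the step into the block descends for a and
   for x1 alike. *)
pose f := (r3.-1, c2).
have fu : f \in u.
  rewrite mu; apply/and3P; split; last 2 [by rewrite /f /a; box_lia].
    by apply: (cA e a) => //; rewrite /f /a; box_lia.
  by rewrite /f /a xpair_eqE; nat_lia.
have [u' ou' mu'] := ordered_ideal A (fun z => (z \in u) && (z != f)).
have u'u z : z \in u' -> z \in u by rewrite mu' => /and3P[].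
have pu : perm_eq u (u' ++ [:: f]).
  apply: uniq_perm; first exact: ordered_uniq.
    rewrite cat_uniq ordered_uniq //= orbF andbT mu' eqxx !andbF //.
  move=> z; rewrite mem_cat mu' inE; case: eqVneq => [->|_]; first by rewrite fu orbT.
  by rewrite andbT orbF mu; case: (z \in A).
have ouf : ordered (u' ++ [:: f]).
  rewrite ordered_cat ou' /=; apply/allrelP => z y zu'; rewrite inE => /eqP->.
  apply/negP => fz; have := zu'; rewrite mu' => /and3P[_ /ua[_ za nza] nzf].
  case: z {zu'} fz za nza nzf => [i j] fz za /eqP.
  by rewrite /f /a !xpair_eqE in fz za *; box_lia.
suff : [:: x1; a; x2; x3] = [:: a; x3; x1; x2] by case; rewrite /x1 /a; nat_lia.
apply: (@des_free_exchange A (u' ++ [:: f]) _ _ v mfA).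
- rewrite catA; apply: LE; first by apply: perm_cat.
  rewrite ordered_cat ouf /=; apply/andP; split.
    by rewrite /ordered /= /a /x1 /x2 /x3; box_lia.
  apply/allrelP => z y; rewrite -(perm_mem pu) => zu.
  have [? ?] := nu z zu; have [? ?] := nux z zu.
  by rewrite !inE => /or4P[]/eqP->.
- perm_tac.
- by rewrite /ordered /= /a /x1 /x2 /x3; box_lia.
- by rewrite /des /= /descends /a /x1 /x2 /x3 /=; do !congr (_ :: _); nat_lia.
- by move=> _; rewrite last_cat /descends /=; nat_lia.
by [].
Qed.

Lemma antichain3_transpose A x1 x2 x3 :
  antichain3 A x1 x2 x3 -> antichain3 (transpose A) (swap x3) (swap x2) (swap x1).
Proof.
case=> h1 h2 h3 /andP[h4 h5] /andP[h6 h7].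
by split; rewrite ?mem_transpose ?swapK //=; apply/andP; split.
Qed.

(** With b the box after the block, x1 x3 x2 <-> x2 x3 x1 fails at its end only if r2 < b.1 <= r1,
    and then x2 x1 x3 <-> x3 x1 x2 is harmless there. At the start, the first exchange wants to be
    preceded by a, which descends to both x1 and x2, and the second by a', which descends to neither
    x2 nor x3; if both corners are present, either can be put last. If neither is, nothing precedes
    the block. A single corner is the previous lemma, up to transposition. *)
Lemma no_antichain3 A x1 x2 x3 : convex A -> des_free A -> ~ antichain3 A x1 x2 x3.
Proof.
move=> cA mfA; pose wt (x : nat * nat) := x.1 + x.2.
have [n] := ubnP (wt x1 + wt x2 + wt x3); elim: n x1 x2 x3 => // n IHn.
move=> [r1 c1] [r2 c2] [r3 c3] ltn acX; have := acX.
rewrite /wt /= in ltn => -[x1A x2A x3A /= /andP[r32 r21] /andP[c12 c23]].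
set x1 := (r1, c1) in x1A acX; set x2 := (r2, c2) in x2A acX.
set x3 := (r3, c3) in x3A acX.
pose a := (r3, c2); pose a' := (r2, c1).
(* By minimality, a box strictly below some x_i cannot replace x_i in the
   antichain, which forces it below one of the corners a, a'. *)
have minX z1 z2 z3 : wt z1 + wt z2 + wt z3 < r1 + c1 + (r2 + c2) + (r3 + c3) ->
    ~ antichain3 A z1 z2 z3.
  by move=> h; apply: IHn; apply: leq_trans h _; rewrite -ltnS.
have h1 z : z \in A -> box_le z x1 -> z = x1 \/ box_le z a' /\ a' \in A.
  case: z => [i j] zA zx; case: (eqVneq (i, j) x1) => [|nz]; [by left | right].
  have hz : i <= r2.
    rewrite leqNgt; apply/negP => ltri; apply: (minX (i, j) x2 x3).
      move: nz; rewrite /x1 xpair_eqE /wt /=; box_lia.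
    split=> //=; box_lia.
  split; first by rewrite /a' /x1 in zx *; box_lia.
  by apply: (cA (i, j) x1) => //; rewrite /a' /x1 in zx *; box_lia.
have h3 z : z \in A -> box_le z x3 -> z = x3 \/ box_le z a /\ a \in A.
  case: z => [i j] zA zx; case: (eqVneq (i, j) x3) => [|nz]; [by left | right].
  have hz : j <= c2.
    rewrite leqNgt; apply/negP => ltri; apply: (minX x1 x2 (i, j)).
      move: nz; rewrite /x3 xpair_eqE /wt /=; box_lia.
    split=> //=; box_lia.
  split; first by rewrite /a /x3 in zx *; box_lia.
  by apply: (cA (i, j) x3) => //; rewrite /a /x3 in zx *; box_lia.
have h2 z : z \in A -> box_le z x2 ->
    [\/ z = x2, box_le z a' /\ a' \in A | box_le z a /\ a \in A].
  case: z => [i j] zA zx; case: (eqVneq (i, j) x2) => [|nz]; first by constructor 1.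
  case: (leqP j c1) => hj.
    constructor 2; split; first by rewrite /a' /x2 in zx *; box_lia.
    by apply: (cA (i, j) x2) => //; rewrite /a' /x2 in zx *; box_lia.
  constructor 3; have hz : i <= r3.
    rewrite leqNgt; apply/negP => ltri; apply: (minX x1 (i, j) x3).
      move: nz; rewrite /x2 xpair_eqE /wt /=; box_lia.
    split=> //=; box_lia.
  split; first by rewrite /a /x2 in zx *; box_lia.
  by apply: (cA (i, j) x2) => //; rewrite /a /x2 in zx *; box_lia.
case: (boolP (a \in A)) (boolP (a' \in A)) => [aA|naA] [a'A|na'A].
- have [u ou mu] := ordered_ideal A
      (fun z => [&& box_le z a || box_le z a', z != a & z != a']).
  have ordu p : ordered p -> {subset p <= [:: a; a'; x1; x2; x3]} -> ordered (u ++ p).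
    move=> op sp; rewrite ordered_cat ou op; apply/allrelP => x y.
    rewrite mu => /and4P[_ hx xa xa'] /sp hy; apply/negP => yx; move: hx xa xa' hy.
    have anti z : box_le x z -> y = z -> x = z.
      by move=> xz ey; apply: box_le_anti => //; rewrite -ey.
    case: x yx anti => [i j] yx anti; rewrite !inE.
    move=> /orP[] xa /eqP na /eqP na' /or4P[/eqP e|/eqP e|/eqP e|/orP[]/eqP e];
    try by [apply: na; apply: anti e | apply: na'; apply: anti e];
    move: yx xa; rewrite e /a /a' /x1 /x2 /x3; box_lia.
  have [|||v Lv] := @lin_ext_extend A (u ++ [:: a'; a; x1; x3; x2]).
  - apply: ordu => [|z]; first by rewrite /ordered /= /a' /a /x1 /x2 /x3; box_lia.
    by rewrite !inE => /or4P[->|->|->|/orP[]->]; rewrite ?orbT.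
  - move=> z; rewrite mem_cat !inE mu.
    by move=> /or4P[/andP[]|/eqP->|/eqP->|/or3P[]/eqP->].
  - have au z : z \in A -> box_le z a \/ box_le z a' ->
        z \in u ++ [:: a'; a; x1; x3; x2].
      move=> zA /orP za; rewrite mem_cat mu zA za !inE.
      by case: (z == a); case: (z == a').
    move=> x z; rewrite {1}mem_cat !inE mu => + zA.
    move=> /or4P[/and4P[_ /orP[]xa _ _] | /eqP-> | /eqP-> | /or3P[]/eqP->] zx.
    + by apply: au => //; left; apply: box_le_trans xa.
    + by apply: au => //; right; apply: box_le_trans xa.
    + by apply: au => //; right.
    + by apply: au => //; left.
    + case: (h1 z zA zx) => [->|[]]; first by rewrite mem_cat !inE eqxx !orbT.
      by move=> ? _; apply: au => //; right.
    + case: (h3 z zA zx) => [->|[]]; first by rewrite mem_cat !inE eqxx !orbT.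
      by move=> ? _; apply: au => //; left.
    case: (h2 z zA zx) => [->|[]|[]]; first by rewrite mem_cat !inE eqxx !orbT.
      by move=> ? _; apply: au => //; right.
    by move=> ? _; apply: au => //; left.
  pose b := head (0, 0) v; case: (boolP (r2 < b.1 <= r1)) => hb.
    suff : [:: x2; x1; x3] = [:: x3; x1; x2] by case; rewrite /x2 /x3; nat_lia.
    apply: (@des_free_exchange A (u ++ [:: a; a']) _ _ v mfA).
    + have E : lin_ext A ([::] ++ (u ++ [:: a'; a; x1; x3; x2]) ++ v) by [].
      rewrite catA -[X in lin_ext A X]cat0s; apply: lin_ext_exchange E _ _.
        by perm_tac.
      rewrite -catA; apply: ordu => [|z]; last first.
        by rewrite !inE => /or4P[->|->|->|/orP[]->]; rewrite ?orbT.
      by rewrite /ordered /= /a' /a /x1 /x2 /x3; box_lia.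
    + by perm_tac.
    + by rewrite /ordered /= /a' /a /x1 /x2 /x3; box_lia.
    + by rewrite /des /= /descends /= /a /x1 /x2 /x3 /=; do !congr (_ :: _); nat_lia.
    + by move=> _; rewrite last_cat /descends /=; nat_lia.
    by move=> _; rewrite /descends /= -/b; nat_lia.
  suff : [:: x1; x3; x2] = [:: x2; x3; x1] by case; rewrite /x2 /x1; nat_lia.
  apply: (@des_free_exchange A (u ++ [:: a'; a]) _ _ v mfA).
  + by rewrite -catA catA in Lv *; rewrite -!catA in Lv *.
  + by perm_tac.
  + by rewrite /ordered /= /a' /a /x1 /x2 /x3; box_lia.
  + by rewrite /des /= /descends /= /a /x1 /x2 /x3 /=; do !congr (_ :: _); nat_lia.
  + by move=> _; rewrite last_cat /descends /=; nat_lia.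
  by move=> _; rewrite /descends /= -/b; move: hb; nat_lia.
- apply: (no_antichain3_corner cA mfA acX) => // z zA zx.
  + by case: (h1 z zA zx) => // -[_]; rewrite (negPf na'A).
  + by case: (h2 z zA zx) => [|[_]|[]]; [left | rewrite (negPf na'A) | right].
  by case: (h3 z zA zx) => [|[]]; [left | right].
- apply: (no_antichain3_corner (convex_transpose cA) (des_free_transpose cA mfA)
      (antichain3_transpose acX)); rewrite ?mem_transpose // => z;
    rewrite mem_transpose => zA zx.
  + case: (h3 (swap z) zA) => [|e|[_]]; rewrite ?(negPf naA) //.
      by rewrite -box_le_swap swapK.
    by rewrite -(swapK z) e.
  + case: (h2 (swap z) zA) => [|e|[za _]|[_]]; rewrite ?(negPf naA) //.
    - by rewrite -box_le_swap swapK.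
    - by left; rewrite -(swapK z) e.
    by right; rewrite -box_le_swap.
  case: (h1 (swap z) zA) => [|e|[za _]].
  - by rewrite -box_le_swap swapK.
  - by left; rewrite -(swapK z) e.
  by right; rewrite -box_le_swap.
have [|||v Lv] := @lin_ext_extend A [:: x1; x3; x2].
- by rewrite /ordered /= /x1 /x2 /x3; box_lia.
- by move=> z; rewrite !inE => /or3P[]/eqP->.
- move=> x z + zA; rewrite !inE => /or3P[]/eqP->.
  + by move=> /(h1 z zA)[->|[_]]; rewrite ?eqxx ?orbT // (negPf na'A).
  + by move=> /(h3 z zA)[->|[_]]; rewrite ?eqxx ?orbT // (negPf naA).
  by move=> /(h2 z zA)[->|[_]|[_]]; rewrite ?eqxx ?orbT // ?(negPf naA) ?(negPf na'A).
pose b := head (0, 0) v; case: (boolP (r2 < b.1 <= r1)) => hb.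
  suff : [:: x2; x1; x3] = [:: x3; x1; x2] by case; rewrite /x2 /x3; nat_lia.
  apply: (@des_free_exchange A [::] _ _ v mfA) => //.
  + have E : lin_ext A ([::] ++ [:: x1; x3; x2] ++ v) by [].
    apply: lin_ext_exchange E _ _; first by perm_tac.
    by rewrite /ordered /= /a' /a /x1 /x2 /x3; box_lia.
  + by perm_tac.
  + by rewrite /ordered /= /a' /a /x1 /x2 /x3; box_lia.
  + by rewrite /des /= /descends /= /a /x1 /x2 /x3 /=; do !congr (_ :: _); nat_lia.
  by move=> _; rewrite /descends /= -/b; nat_lia.
suff : [:: x1; x3; x2] = [:: x2; x3; x1] by case; rewrite /x2 /x1; nat_lia.
apply: (@des_free_exchange A [::] _ _ v mfA) => //.
+ by perm_tac.
+ by rewrite /ordered /= /a' /a /x1 /x2 /x3; box_lia.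
+ by rewrite /des /= /descends /= /a /x1 /x2 /x3 /=; do !congr (_ :: _); nat_lia.
by move=> _; rewrite /descends /= -/b; move: hb; nat_lia.
Qed.

(** * Two-row shapes *)

(** The shuffle of p and q prescribed by t. It stops as soon as the list asked for is exhausted,
    whence the counting hypotheses of the lemmas on it. *)
Fixpoint weave (T : Type) (t : seq bool) (p q : seq T) : seq T :=
  match t, p, q with
  | false :: t', x :: p', _ => x :: weave t' p' q
  | true :: t', _, y :: q' => y :: weave t' p q'
  | _, _, _ => [::]
  end.

Lemma perm_weave (T : eqType) t (p q : seq T) :
  count_mem false t = size p -> count_mem true t = size q ->
  perm_eq (weave t p q) (p ++ q).
Proof.
elim: t p q => [|[] t IHt] [|x p] [|y q] //= [h1] [h2]; rewrite ?add0n in h1 h2.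
- by rewrite perm_cons; apply: (IHt [::]).
- rewrite perm_sym (perm_catCA (x :: p) [:: y] q) perm_cons perm_sym.
  exact: (IHt (x :: p) q).
- by rewrite perm_cons; apply: IHt.
by rewrite perm_cons; apply: IHt.
Qed.

Lemma mem_weave (T : eqType) t (p q : seq T) : {subset weave t p q <= p ++ q}.
Proof.
elim: t p q => [|[] t IHt] [|x p] [|y q] //= z.
- by rewrite !inE => /orP[->//|/IHt /= ->]; rewrite orbT.
- rewrite !inE mem_cat !inE => /orP[->|/IHt]; first by rewrite !orbT.
  by rewrite mem_cat inE => /orP[/orP[]->|->]; rewrite ?orbT.
- by rewrite !inE => /orP[->//|/IHt ->]; rewrite orbT.
by rewrite !inE => /orP[->//|/IHt ->]; rewrite orbT.
Qed.

Lemma map_weave (T : Type) (f : T -> bool) t (p q : seq T) :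
  count_mem false t = size p -> count_mem true t = size q ->
  all (predC f) p -> all f q -> map f (weave t p q) = t.
Proof.
elim: t p q => [|[] t IHt] [|x p] [|y q] //= [h1] [h2] => [_|hp|/andP[/negPf hx hp] _|/andP[/negPf hx hp]].
- by case/andP=> -> hq; rewrite (IHt [::]).
- by case/andP=> -> hq; rewrite (IHt (x :: p)).
- by rewrite hx IHt.
by move=> hq; rewrite hx IHt.
Qed.

Definition rowl (i a k : nat) : seq (nat * nat) := [seq (i, j) | j <- iota a k].

Lemma mem_rowl i a k (x : nat * nat) : (x \in rowl i a k) = (x.1 == i) && (a <= x.2 < a + k).
Proof.
case: x => [u v]; apply/mapP/andP => /= [[j]|[/eqP-> h]].
  by rewrite mem_iota => h [-> ->].
by exists v; rewrite ?mem_iota.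
Qed.

(* [ballot a b k t] says that placing boxes from left to right in row 1
   (letter true) and row 0 (letter false) in the order prescribed by t is
   compatible with column increase, when the next free column is a in row 0
   and b in row 1, and k boxes of row 0 remain. *)
Fixpoint ballot (a b k : nat) (t : seq bool) : bool :=
  match t with
  | false :: t' => ballot a.+1 b k.-1 t'
  | true :: t' => ((b < a) || (k == 0)) && ballot a b.+1 k t'
  | [::] => true
  end.

Lemma ballot_false a b k i t :
  ballot a b k (nseq i false ++ t) = ballot (a + i) b (k - i) t.
Proof.
by elim: i a k => [|i IHi] a k /=; rewrite ?addn0 ?subn0 // IHi addSnnS -subn1 -subnDA.
Qed.

Lemma ballot_true a b k i t : (b + i <= a) || (k == 0) ->
  ballot a b k (nseq i true ++ t) = ballot a (b + i) k t.
Proof.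
elim: i b => [|i IHi] b /=; rewrite ?addn0 // => h; rewrite IHi ?addSnnS //.
by have -> : (b < a) || (k == 0) by move: h; case: (k == 0); lia.
Qed.

Lemma ordered_weave a b k m t :
  ballot a b k t -> ordered (weave t (rowl 0 a k) (rowl 1 b m)).
Proof.
elim: t a b k m => [|[] t IHt] a b k m /=.
- by case: (rowl _ _ _).
- move=> /andP[hab ht]; case: m => [|m]; first by case: k {IHt ht hab}.
  rewrite /= -/(rowl 1 b.+1 m).
  suff : ordered ((1, b) :: weave t (rowl 0 a k) (rowl 1 b.+1 m)) by case: (k).
  rewrite /ordered /= -/(ordered _) IHt // andbT.
  apply/allP => z /mem_weave; rewrite mem_cat !mem_rowl /box_le /=.
  by move: hab; case: z => [u v] /=; lia.
move=> ht; case: k ht => [|k] //= ht.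
rewrite -/(rowl 0 a.+1 k) /ordered /= -/(ordered _) IHt // andbT.
apply/allP => z /mem_weave; rewrite mem_cat !mem_rowl /box_le /=.
by case: z => [u v] /=; lia.
Qed.

(** In two rows a descent is a letter [false] followed by [true]. The initial value [true] only
    produces the letter that [behead] removes. *)
Definition asc_word (t : seq bool) : seq bool :=
  behead (pairmap (fun a b => ~~ a && b) true t).

Lemma des_two_rows l : all (fun z => z.1 <= 1) l ->
  des l = asc_word [seq 0 < z.1 | z <- l].
Proof.
case: l => [|x l] //; rewrite /des /asc_word /=.
elim: l x => //= y l IHl x /and3P[hx hy hl]; rewrite IHl /= ?hy //.
by congr (_ :: _); rewrite /descends; lia.
Qed.

Lemma pairmap_asc_nseq a b k t :
  pairmap (fun a b => ~~ a && b) a (nseq k.+1 b ++ t) =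
  (~~ a && b) :: nseq k false ++ pairmap (fun a b => ~~ a && b) b t.
Proof.
rewrite /=; congr (_ :: _); elim: k => //= k ->.
by case: b.
Qed.

Definition two_rows (s x y : nat) (N : diagram) : Prop :=
  forall z : nat * nat, z \in N = (z \in rowl 0 s x) || (z \in rowl 1 0 y).

Lemma lin_ext_weave s x y N t : two_rows s x y N ->
  count_mem false t = x -> count_mem true t = y -> ballot s 0 x t ->
  lin_ext N (weave t (rowl 0 s x) (rowl 1 0 y)).
Proof.
move=> hN cf ct bt; split=> [z|]; last exact: ordered_weave.
by rewrite (perm_mem (perm_weave _ _)) ?size_map ?size_iota // mem_cat hN.
Qed.

Lemma type_weave s x y t : count_mem false t = x -> count_mem true t = y ->
  [seq 0 < z.1 | z <- weave t (rowl 0 s x) (rowl 1 0 y)] = t.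
Proof.
move=> cf ct; rewrite map_weave ?size_map ?size_iota //.
  by apply/allP => z; rewrite mem_rowl /= => /andP[/eqP->].
by apply/allP => z; rewrite mem_rowl /= => /andP[/eqP->].
Qed.

Lemma des_weave s x y t : count_mem false t = x -> count_mem true t = y ->
  des (weave t (rowl 0 s x) (rowl 1 0 y)) = asc_word t.
Proof.
move=> cf ct; rewrite des_two_rows ?type_weave //.
apply/allP => z /mem_weave; rewrite mem_cat !mem_rowl => /orP[]/andP[/eqP->] //.
Qed.

Lemma two_rows_free s x y N t t' : two_rows s x y N -> des_free N ->
  count_mem false t = x -> count_mem true t = y -> ballot s 0 x t ->
  count_mem false t' = x -> count_mem true t' = y -> ballot s 0 x t' ->
  asc_word t = asc_word t' -> t = t'.
Proof.
move=> hN mfN cf ct bt cf' ct' bt' E.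
rewrite -(type_weave s cf ct) -(type_weave s cf' ct'); congr map.
by apply: mfN; rewrite ?des_weave //; apply: lin_ext_weave.
Qed.

(** The words 0^x 1^y and 1 0^(x-1) 1^(y-1) 0 both have their only ascent after x letters. The left
    overhang 0 < s permits the leading 1, the right overhang y < s + x permits the final 0. *)
Lemma two_rows_overhang s x y N : two_rows s x y N -> des_free N ->
  0 < s -> y < s + x -> x <= 1 \/ y <= 1.
Proof.
move=> hN mfN s0 ysx; case: (leqP x 1) => [|x1]; [by left | right].
rewrite leqNgt; apply/negP => y1.
have [x' Ex] : exists x', x = x'.+2 by exists x.-2; lia.
have [y' Ey] : exists y', y = y'.+2 by exists y.-2; lia.
subst x y.
suff : nseq x'.+2 false ++ nseq y'.+2 true ++ [::] =
       nseq 1 true ++ nseq x'.+1 false ++ nseq y'.+1 true ++ [:: false] by [].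
apply: (two_rows_free hN mfN).
- by rewrite !count_cat !count_nseq /=; lia.
- by rewrite !count_cat !count_nseq /=; lia.
- by rewrite ballot_false ballot_true //; lia.
- by rewrite !count_cat !count_nseq /=; lia.
- by rewrite !count_cat !count_nseq /=; lia.
- by rewrite ballot_true ?ballot_false ?ballot_true //; lia.
rewrite /asc_word !pairmap_asc_nseq /=.
congr (_ :: _); congr (_ ++ _ :: _); rewrite cats0.
by elim: (y') => //= ? <-.
Qed.

(** For x = y >= 5, the words 00 1 00 11 0^(y-4) 1^(y-3) and 00 11 0 1 0^(y-3) 1^(y-3) ascend after
    2, 5 and y+3 letters; the block 0^(y-4) must be nonempty, hence the bound 4. For 3 <= y < x, the
    words 00 1 0^(x-2) 1^(y-1) and 00 11 0^(x-3) 1^(y-2) 0 ascend after 2 and x+1 letters; the final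
    0 requires y < x. *)
Lemma two_rows_straight x y N : two_rows 0 x y N -> des_free N ->
  y <= x -> y <= 2 \/ x = y /\ y <= 4.
Proof.
move=> hN mfN lyx; case: (leqP y 2) => [|y2]; [by left | right].
case: (ltnP y x) => [ltyx|lexy]; last first.
  have {lyx lexy} Ex : x = y by lia.
  subst x; split=> //; rewrite leqNgt; apply/negP => y4.
  have [k Ek] : exists k, y = k + 5 by exists (y - 5); lia.
  subst y.
  suff : nseq 2 false ++ nseq 1 true ++ nseq 2 false ++ nseq 2 true ++
           nseq k.+1 false ++ nseq k.+2 true ++ [::] =
         nseq 2 false ++ nseq 2 true ++ nseq 1 false ++ nseq 1 true ++
           nseq k.+2 false ++ nseq k.+2 true ++ [::] by [].
  apply: (two_rows_free hN mfN).
  - by rewrite !count_cat !count_nseq /=; lia.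
  - by rewrite !count_cat !count_nseq /=; lia.
  - by rewrite !(ballot_false, ballot_true) //; lia.
  - by rewrite !count_cat !count_nseq /=; lia.
  - by rewrite !count_cat !count_nseq /=; lia.
  - by rewrite !(ballot_false, ballot_true) //; lia.
  by rewrite /asc_word !pairmap_asc_nseq.
have [k Ek] : exists k, y = k + 3 by exists (y - 3); lia.
have [j Ej] : exists j, x = k + j + 4 by exists (x - k - 4); lia.
subst x y.
suff : nseq 2 false ++ nseq 1 true ++ nseq (k + j).+2 false ++ nseq k.+2 true ++ [::] =
       nseq 2 false ++ nseq 2 true ++ nseq (k + j).+1 false ++ nseq k.+1 true ++
         nseq 1 false ++ [::] by [].
apply: (two_rows_free hN mfN).
- by rewrite !count_cat !count_nseq /=; lia.
- by rewrite !count_cat !count_nseq /=; lia.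
- by rewrite !(ballot_false, ballot_true) //; lia.
- by rewrite !count_cat !count_nseq /=; lia.
- by rewrite !count_cat !count_nseq /=; lia.
- by rewrite !(ballot_false, ballot_true) //; lia.
rewrite /asc_word !pairmap_asc_nseq /= !cats0.
do 4 congr (_ :: _); congr (_ ++ _ :: _).
by elim: (k) => //= ? <-.
Qed.

(** * Symmetries and the multiplicity-free shapes *)

Lemma mem_young la (x : nat * nat) : (x \in young la) = (x.2 < nth 0 la x.1).
Proof.
case: x => [i j]; rewrite in_fset; apply/allpairsPdep/idP => /= [[u [v [hu hv]]]|hj].
  by case=> -> ->; move: hv; rewrite mem_iota.
exists i, j; rewrite !mem_iota !add0n /=; split=> //.
by rewrite ltnNge; apply/negP => /(nth_default 0) E; rewrite E in hj.
Qed.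

Lemma mem_rows (A : diagram) i : reflect (exists j, (i, j) \in A) (i \in rows A).
Proof.
apply: (iffP (imfsetP _ _ _ _)) => [[[u v] /= uA ->]|[j ijA]]; first by exists v.
by exists (i, j).
Qed.

Lemma mem_cols (A : diagram) j : reflect (exists i, (i, j) \in A) (j \in cols A).
Proof.
apply: (iffP (imfsetP _ _ _ _)) => [[[u v] /= uA ->]|[i ijA]]; first by exists u.
by exists (i, j).
Qed.

(** The normal form produced by [compress]: the bounding box is m by r and no line of it is
    empty. *)
Definition full (A : diagram) (m r : nat) : Prop :=
  (forall i, (i \in rows A) = (i < m)) /\ (forall j, (j \in cols A) = (j < r)).

Lemma max_succ_fset (s : {fset nat}) m : (forall i, (i \in s) = (i < m)) ->
  \max_(i <- s) i.+1 = m.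
Proof.
move=> hs; apply/eqP; rewrite eqn_leq; apply/andP; split.
  by apply/bigmax_leqP_seq => i; rewrite hs.
case: m hs => // m hs; by apply: (@leq_bigmax_seq _ _ predT succn m); rewrite ?hs.
Qed.

Section Full.
Variables (A : diagram) (m r : nat).
Hypothesis fA : full A m r.

Lemma full_lt (x : nat * nat) : x \in A -> x.1 < m /\ x.2 < r.
Proof.
case: fA => h1 h2; case: x => i j ijA.
by split; [rewrite -h1; apply/mem_rows; exists j | rewrite -h2; apply/mem_cols; exists i].
Qed.

Lemma full_row i : i < m -> exists j, (i, j) \in A.
Proof. by case: fA => h1 _; rewrite -h1 => /mem_rows. Qed.

Lemma full_col j : j < r -> exists i, (i, j) \in A.
Proof. by case: fA => _ h2; rewrite -h2 => /mem_cols. Qed.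

Definition rot_box (x : nat * nat) := (m - x.1.+1, r - x.2.+1).

Lemma antipode_full : antipode A = [fset rot_box x | x in A].
Proof.
case: fA => h1 h2; rewrite /antipode /height /width.
by rewrite (max_succ_fset h1) (max_succ_fset h2).
Qed.

Lemma rot_boxK x : x.1 < m -> x.2 < r -> rot_box (rot_box x) = x.
Proof. by case: x => i j /= *; rewrite /rot_box /=; congr pair; lia. Qed.

Lemma mem_antipode (x : nat * nat) :
  (x \in antipode A) = [&& x.1 < m, x.2 < r & rot_box x \in A].
Proof.
rewrite antipode_full; apply/imfsetP/and3P => [[y yA ->]|[h1 h2 xA]].
  have [y1 y2] := full_lt yA; rewrite rot_boxK //; split=> //=; lia.
by exists (rot_box x); rewrite ?rot_boxK.
Qed.

Lemma full_antipode : full (antipode A) m r.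
Proof.
split=> i.
  apply/mem_rows/idP => [[j]|lim]; first by rewrite mem_antipode => /and3P[].
  have [|j hj] := @full_row (m - i.+1); first by lia.
  have [_ /= ltj] := full_lt hj.
  exists (r - j.+1); rewrite mem_antipode /= lim /rot_box /=.
  by rewrite (_ : r - (r - j.+1).+1 = j) ?hj; lia.
apply/mem_cols/idP => [[j]|lim]; first by rewrite mem_antipode => /and3P[].
have [|j hj] := @full_col (r - i.+1); first by lia.
have [/= ltj _] := full_lt hj.
exists (m - j.+1); rewrite mem_antipode /= lim /rot_box /=.
by rewrite (_ : m - (m - j.+1).+1 = j) ?hj; lia.
Qed.

Lemma box_le_rot x y : x.1 < m -> x.2 < r -> y.1 < m -> y.2 < r ->
  box_le (rot_box x) (rot_box y) = box_le y x.
Proof. by rewrite /box_le /rot_box /=; lia. Qed.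

Lemma convex_antipode : convex A -> convex (antipode A).
Proof.
move=> cA x y z; rewrite !mem_antipode => /and3P[x1 x2 xA] /and3P[y1 y2 yA] xz zy.
have [z1 z2] : z.1 < m /\ z.2 < r 
  by case/andP: zy => ? ?; split; [apply: leq_ltn_trans y1 | apply: leq_ltn_trans y2].
by rewrite z1 z2 /=; apply: (cA _ _ _ yA xA); rewrite box_le_rot.
Qed.

Lemma lin_ext_antipode l :
  lin_ext A l -> lin_ext (antipode A) (rev (map rot_box l)).
Proof.
move=> [memA ordA]; split=> [x|].
  rewrite mem_rev antipode_full.
  by apply/mapP/imfsetP => -[y yA ->]; exists y; rewrite // ?memA // -memA.
have hl y : y \in l -> y.1 < m /\ y.2 < r by rewrite memA => /full_lt.
elim: l {memA} hl ordA => //= y l IHl hl /andP[/allP hy /IHl ol].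
rewrite rev_cons -cats1 ordered_cat ol /=; last first.
  by move=> z zl; apply: hl; rewrite inE zl orbT.
apply/allrelP => z w; rewrite mem_rev inE => /mapP[{}z zl ->] /eqP->.
have [? ?] := hl y (mem_head _ _).
have [|? ?] := hl z; first by rewrite inE zl orbT.
by rewrite box_le_rot // hy.
Qed.

(** Rotation reverses the order of the rows and [rev] the order of the steps, so each letter is kept
    and the word is read backwards. *)
Lemma des_rev_rot l : {subset l <= A} ->
  des (rev (map rot_box l)) = rev (des l).
Proof.
elim: l => [|x [|y l] IHl] //= sl.
have [x1 x2] := full_lt (sl x (mem_head _ _)).
have [|y1 y2] := @full_lt y; first by apply: sl; rewrite !inE eqxx orbT.
have -> : des [:: x, y & l] = descends x y :: des (y :: l) by [].
rewrite [RHS]rev_cons -IHl => [|z zl]; last by apply: sl; rewrite inE zl orbT.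
rewrite /= !rev_cons -[X in des X]cats1 des_cat cats1; congr rcons.
by rewrite /descends /rot_box /=; lia.
Qed.

End Full.

Lemma antipodeK A m r : full A m r -> antipode (antipode A) = A.
Proof.
move=> fA; apply/fsetP => x; rewrite (mem_antipode (full_antipode fA)).
rewrite (mem_antipode fA) /=; apply/and3P/idP => [[h1 h2 /and3P[_ _]]|xA].
  by rewrite (rot_boxK h1 h2).
have [h1 h2] := full_lt fA xA; rewrite h1 h2 rot_boxK //; split=> //.
by rewrite xA andbT; apply/andP; split; lia.
Qed.

Lemma has_des_antipode A m r w : full A m r ->
  has_des (antipode A) w <-> has_des A (rev w).
Proof.
move=> fA; split=> [] [l Ll El].
  have Ll' := lin_ext_antipode (full_antipode fA) Ll.
  rewrite (antipodeK fA) in Ll'; exists (rev (map (rot_box m r) l)) => //.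
  rewrite (des_rev_rot (full_antipode fA)) ?El // => x.
  by case: Ll => ->.
exists (rev (map (rot_box m r) l)); first exact: lin_ext_antipode.
by rewrite (des_rev_rot fA) ?El ?revK // => x; case: Ll => ->.
Qed.

Lemma des_free_antipode A m r : full A m r -> des_free A -> des_free (antipode A).
Proof.
move=> fA mfA l l' Ll Ll' E; have fA' := full_antipode fA.
have L1 := lin_ext_antipode fA' Ll; have L2 := lin_ext_antipode fA' Ll'.
rewrite (antipodeK fA) in L1 L2.
have /(can_inj revK) : rev (map (rot_box m r) l) = rev (map (rot_box m r) l').
  apply: mfA => //; rewrite !(des_rev_rot fA') ?E // => x; first by case: Ll' => ->.
  by case: Ll => ->.
have hl s : lin_ext (antipode A) s -> map (rot_box m r) (map (rot_box m r) s) = s.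
  move=> [ms _]; rewrite -map_comp -[RHS]map_id; apply/eq_in_map => x.
  by rewrite ms => /(full_lt fA')[? ?] /=; rewrite rot_boxK.
by move=> /(congr1 (map (rot_box m r))); rewrite !hl.
Qed.

Lemma full_transpose A m r : full A m r -> full (transpose A) r m.
Proof.
case=> h1 h2; split=> i.
  rewrite -h2; apply/mem_rows/mem_cols => -[j]; exists j; move: p;
  by rewrite mem_transpose.
rewrite -h1; apply/mem_cols/mem_rows => -[j]; exists j; move: p;
by rewrite mem_transpose.
Qed.

Lemma antipode_transpose A m r : full A m r ->
  antipode (transpose A) = transpose (antipode A).
Proof.
move=> fA; apply/fsetP => x; rewrite (mem_antipode (full_transpose fA)).
by rewrite !mem_transpose (mem_antipode fA) /= andbCA.
Qed.

(** The shapes to which the classification leads, up to rotation; the suffix T marks a transpose.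
    Single rows and columns are hooks, and the 2 x 2 square is both [Two] and [TwoT] for n = 4. *)
Inductive kind : Set :=
| Hook of nat | Bi of nat | Two | TwoT | Rect of nat | RectT of nat.

Definition kind_diagram (n : nat) (k : kind) : diagram :=
  match k with
  | Hook l => young (n - l :: nseq l 1)
  | Bi l => dsum (young (nseq l 1)) (young [:: n - l])
  | Two => young [:: n - 2; 2]
  | TwoT => young [:: 2, 2 & nseq (n - 4) 1]
  | Rect k => young [:: k; k]
  | RectT k => young (nseq k 2)
  end.

Definition valid (n : nat) (k : kind) : bool :=
  match k with
  | Hook l => l < n
  | Bi l => 1 <= l <= n - 1
  | Two | TwoT => 4 <= n
  | Rect k | RectT k => (n == 2 * k) && ((k == 3) || (k == 4))
  end.

(** Membership in [kind_diagram] written as inequalities on coordinates, a form in which comparisons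
    of diagrams become linear arithmetic (see [mem_shape]). *)
Definition in_shape (n : nat) (k : kind) (x : nat * nat) : bool :=
  match k with
  | Hook l => (x.1 == 0) && (x.2 < n - l) || (0 < x.1 <= l) && (x.2 == 0)
  | Bi l => (x.1 == 0) && (0 < x.2 <= n - l) || (0 < x.1 <= l) && (x.2 == 0)
  | Two => (x.1 == 0) && (x.2 < n - 2) || (x.1 == 1) && (x.2 < 2)
  | TwoT => (x.2 == 0) && (x.1 < n - 2) || (x.2 == 1) && (x.1 < 2)
  | Rect k => (x.1 < 2) && (x.2 < k)
  | RectT k => (x.2 < 2) && (x.1 < k)
  end.

Lemma full_young1 l : full (young (nseq l.+1 1)) l.+1 1.
Proof.
have memy x : (x \in young (nseq l.+1 1)) = (x.1 < l.+1) && (x.2 == 0).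
  by rewrite mem_young nth_nseq; case: ifP => //= _; lia.
split=> i.
  apply/mem_rows/idP => [[j]|h]; first by rewrite memy => /andP[].
  by exists 0; rewrite memy h.
apply/mem_cols/idP => [[j]|]; first by rewrite memy /=; lia.
by rewrite ltnS leqn0 => /eqP->; exists 0; rewrite memy.
Qed.

Lemma full_row1 l : full (young [:: l.+1]) 1 l.+1.
Proof.
have memy x : (x \in young [:: l.+1]) = (x.1 == 0) && (x.2 < l.+1).
  by rewrite mem_young; case: x => [[|i] j] //=; rewrite nth_nil.
split=> i.
  apply/mem_rows/idP => [[j]|]; first by rewrite memy /=; lia.
  by rewrite ltnS leqn0 => /eqP->; exists 0; rewrite memy.
apply/mem_cols/idP => [[j]|h]; first by rewrite memy => /andP[].
by exists 0; rewrite memy.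
Qed.

Lemma mem_shape n k (x : nat * nat) : valid n k -> (x \in kind_diagram n k) = in_shape n k x.
Proof.
case: k => [l|l|||k|k] /=; case: x => [i j].
- move=> ln; rewrite mem_young /=; case: i => [|i] /=; first by rewrite orbF.
  by rewrite nth_nseq; case: (ltnP i l) => /= *; lia.
- case: l => // l hl; have [k Ek] : exists k, n - l.+1 = k.+1 by exists (n - l.+2); lia.
  rewrite Ek /dsum /height /width.
  rewrite (max_succ_fset (proj1 (full_row1 k))) (max_succ_fset (proj2 (full_young1 l))).
  rewrite in_fsetU; apply/orP/idP => [[]/imfsetP[[u v]]|].
  + rewrite mem_young nth_nseq /= => h [-> ->]; by move: h; case: (ltnP u l.+1) => /= *; lia.
  + rewrite mem_young /=; case: u => [|u] /= h [-> ->]; first by rewrite h.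
    by rewrite nth_nil in h.
  case/orP => /andP[/= h1 h2].
    right; apply/imfsetP; exists (0, j.-1); first by rewrite mem_young /=; lia.
    by congr pair => /=; lia.
  left; apply/imfsetP; exists (i.-1, 0); last by congr pair => /=; lia.
  by rewrite mem_young -[1 :: _]/(nseq l.+1 1) nth_nseq /=; case: (ltnP i.-1 l.+1); lia.
- by move=> n4; rewrite mem_young /=; case: i => [|[|i]] /=; rewrite ?nth_nil ?orbF.
- move=> n4; rewrite mem_young; case: i => [|[|i]] /=; rewrite ?nth_nseq; try lia.
  by case: (ltnP i (n - 4)) => /= *; lia.
- by move=> _; rewrite mem_young /=; case: i => [|[|i]] /=; rewrite ?nth_nil.
by move=> _; rewrite mem_young nth_nseq /=; case: (ltnP i k) => /=; lia.
Qed.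

Definition dual (n : nat) (k : kind) : kind :=
  match k with
  | Hook l => Hook (n - l.+1)
  | Bi l => Bi (n - l)
  | Two => TwoT
  | TwoT => Two
  | Rect k => RectT k
  | RectT k => Rect k
  end.

Lemma valid_dual n k : valid n k -> valid n (dual n k).
Proof. by case: k => //= l; lia. Qed.

Lemma transpose_shape n k : valid n k -> transpose (kind_diagram n k) = kind_diagram n (dual n k).
Proof.
move=> vk; apply/fsetP => -[i j].
rewrite mem_transpose !mem_shape ?valid_dual //.
by case: k vk => [l|l|||k|k] //=; lia.
Qed.

Lemma full_shape n k : valid n k -> exists m r, full (kind_diagram n k) m r.
Proof.
move=> vk; have E := fun x => mem_shape x vk.
suff [m [r [H1 H2 H3]]] : exists m r,
  [/\ forall i j, in_shape n k (i, j) -> i < m /\ j < r,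
      forall i, i < m -> exists j, in_shape n k (i, j) &
      forall j, j < r -> exists i, in_shape n k (i, j)].
  exists m, r; split=> i.
    apply/mem_rows/idP => [[j]|/H2[j hj]]; first by rewrite E => /H1[].
    by exists j; rewrite E.
  apply/mem_cols/idP => [[j]|/H3[j hj]]; first by rewrite E => /H1[].
  by exists j; rewrite E.
case: k vk {E} => [l|l|||k|k] /= vk.
- exists l.+1, (n - l); split=> [i j|[|i] hi|[|j] hj] /=; try lia.
  + by exists 0; lia.
  + by exists 0; lia.
  + by exists 0; lia.
  by exists 0; lia.
- exists l.+1, (n - l).+1; split=> [i j|[|i] hi|[|j] hj] /=; try lia.
  + by exists 1; lia.
  + by exists 0; lia.
  + by exists 1; lia.
  by exists 0; lia.
- exists 2, (n - 2); split=> [i j|i hi|j hj]; try lia.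
    by exists 0; lia.
  by exists 0; lia.
- exists (n - 2), 2; split=> [i j|i hi|j hj]; try lia.
    by exists 0; lia.
  by exists 0; lia.
- exists 2, k; split=> [i j|i hi|j hj]; first (by move/andP); exists 0; rewrite /=; lia.
by exists k, 2; split=> [i j|i hi|j hj]; first (by case/andP); exists 0; rewrite /=; lia.
Qed.

(** * Classification *)

Definition classified (N : diagram) : Prop :=
  exists n k, valid n k /\ (N = kind_diagram n k \/ antipode N = kind_diagram n k).

Lemma classified_antipode N m r :
  full N m r -> classified (antipode N) -> classified N.
Proof.
move=> fN [n [k [vk h]]]; exists n, k; split=> //.
by rewrite (antipodeK fN) in h; case: h; [right | left].
Qed.

Lemma classified_transpose N m r :
  full N m r -> classified (transpose N) -> classified N.
Proof.
move=> fN [n [k [vk h]]]; exists n, (dual n k); split; first exact: valid_dual.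
rewrite -transpose_shape // -[N]transposeK; case: h => [->|h]; [by left | right].
by rewrite (antipode_transpose (full_transpose fN)) h.
Qed.

Lemma eq_shape N n k : valid n k ->
  (forall x : nat * nat, (x \in N) = in_shape n k x) -> N = kind_diagram n k.
Proof. by move=> vk h; apply/fsetP => x; rewrite h mem_shape. Qed.

Lemma classify_straight x y N : two_rows 0 x y N -> des_free N ->
  0 < y <= x -> classified N.
Proof.
move=> hN mfN /andP[y0 yx].
have mN z : (z \in N) = (z.1 == 0) && (z.2 < x) || (z.1 == 1) && (z.2 < y).
  by rewrite hN !mem_rowl.
have [E|E] : y = 1 \/ 1 < y by lia.
  exists x.+1, (Hook 1); split; first by rewrite /=; lia.
  by left; apply: eq_shape => [|z]; rewrite ?mN /=; lia.
have [E2|E2] : y = 2 \/ 2 < y by lia.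
  exists (x + 2), Two; split; first by rewrite /=; lia.
  by left; apply: eq_shape => [|z]; rewrite ?mN /=; lia.
have [|[Ex y4]] := two_rows_straight hN mfN yx; first by lia.
exists (2 * y), (Rect y); split; first by rewrite /=; lia.
by left; apply: eq_shape => [|z]; rewrite ?mN /=; lia.
Qed.

Lemma interval_row (N : diagram) (i a j b : nat) : convex N ->
  (i, a) \in N -> (i, b) \in N -> a <= j <= b -> (i, j) \in N.
Proof. by move=> cN ha hb hj; apply: (cN _ _ _ ha hb); rewrite /box_le /=; lia. Qed.

Lemma interval_col (N : diagram) (j a i b : nat) : convex N ->
  (a, j) \in N -> (b, j) \in N -> a <= i <= b -> (i, j) \in N.
Proof. by move=> cN ha hb hj; apply: (cN _ _ _ ha hb); rewrite /box_le /=; lia. Qed.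

Section Convex.
Variables (N : diagram) (m r : nat).
Hypotheses (fN : full N m r) (cN : convex N) (mfN : des_free N).
Hypotheses (m0 : 0 < m) (r0 : 0 < r).

(** The corner lies between some box of the first row and some box of the last column. *)
Lemma corner_ne : (0, r.-1) \in N.
Proof.
have [i hi] := @full_col _ _ _ fN r.-1 ltac:(lia).
have [j hj] := @full_row _ _ _ fN 0 m0.
have [_ /= ltj] := full_lt fN hj.
by apply: (cN hj hi); rewrite /box_le /=; lia.
Qed.

Lemma corner_sw : (m.-1, 0) \in N.
Proof.
have [i hi] := @full_col _ _ _ fN 0 r0.
have [j hj] := @full_row _ _ _ fN m.-1 ltac:(lia).
have [/= lti _] := full_lt fN hi.
by apply: (cN hi hj); rewrite /box_le /=; lia.
Qed.

Lemma classify_row : m = 1 -> classified N.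
Proof.
move=> m1; exists r, (Hook 0); split; first by rewrite /=; lia.
left; apply: eq_shape => [|[i j]]; first by rewrite /=; lia.
have sw := corner_sw; rewrite m1 /= in sw.
apply/idP/idP => [/(full_lt fN)[]|]; first by rewrite /=; lia.
rewrite /= => h; have -> : i = 0 by lia.
by apply: (interval_row cN sw corner_ne); lia.
Qed.

Lemma classify_two_rows : m = 2 -> classified N.
Proof.
move=> m2; have sw := corner_sw; have ne := corner_ne; rewrite m2 /= in sw.
(* By convexity row 0 occupies exactly the columns from s on, and row 1 exactly those before y. *)
have [|s hs mins] := @ex_minnP (fun j => (0, j) \in N); first by exists r.-1.
have [|y hy miny] := @ex_minnP (fun j => (1, j) \notin N).
  by exists r; apply/negP => /(full_lt fN)[_] /=; rewrite ltnn.
have sr : s < r by have := mins _ ne; lia.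
have y0 : 0 < y by case: y hy {miny} => //; rewrite sw.
have yr : y <= r by apply: miny; apply/negP => /(full_lt fN)[_] /=; rewrite ltnn.
have y1 j : j < y -> (1, j) \in N.
  by move=> jy; apply: contraLR jy => /miny; rewrite -leqNgt.
have hN : two_rows s (r - s) y N.
  move=> [i j]; rewrite !mem_rowl /=; apply/idP/idP => [ijN|].
    have [/= im jr] := full_lt fN ijN.
    have [i0|i1] : i = 0 \/ i = 1 by lia.
      by rewrite i0 in ijN *; have := mins _ ijN; lia.
    rewrite i1 in ijN *; suff : j < y by lia.
    rewrite ltnNge; apply/negP => yj; move: hy; rewrite (interval_row cN sw ijN) //; lia.
  case/orP => /andP[/eqP-> hj]; last by apply: y1; lia.
  by apply: (interval_row cN hs ne); lia.
have sy : s <= y.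
  rewrite leqNgt; apply/negP => ys.
  have [i] := @full_col _ _ _ fN y ltac:(lia).
  by rewrite hN !mem_rowl /=; lia.
have [s0|s0] : s = 0 \/ 0 < s by lia.
  by rewrite s0 subn0 in hN; apply: classify_straight hN mfN _; lia.
have [yr'|yr'] : y = r \/ y < r by lia.
  apply: (classified_antipode fN).
  apply: (@classify_straight r (r - s)).
  - by move=> z; rewrite (mem_antipode fN) m2 hN !mem_rowl /rot_box /=; lia.
  - exact: des_free_antipode fN mfN.
  by lia.
have [|rs|y1'] := two_rows_overhang hN mfN s0; first by lia.
  exists r, (Bi 1); split; first by rewrite /=; lia.
  right; apply: eq_shape => [|z]; first by rewrite /=; lia.
  by rewrite (mem_antipode fN) m2 hN !mem_rowl /rot_box /=; lia.
exists r, (Bi 1); split; first by rewrite /=; lia.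
left; apply: eq_shape => [|z]; first by rewrite /=; lia.
by rewrite hN !mem_rowl /=; lia.
Qed.

Hypotheses (m3 : 2 < m) (r3 : 2 < r).

Lemma on_border (x : nat * nat) : x \in N -> [|| x.1 == 0, x.2 == r.-1, x.1 == m.-1 | x.2 == 0].
Proof.
case: x => [i j] ijN; have [/= im jr] := full_lt fN ijN.
apply/negPn/negP => h.
apply: (@no_antichain3 N (m.-1, 0) (i, j) (0, r.-1) cN mfN).
split; rewrite ?corner_sw ?corner_ne //=; lia.
Qed.

Lemma classify_nw : (0, 0) \in N -> N = kind_diagram (m.-1 + r) (Hook m.-1).
Proof.
move=> nw; apply: eq_shape => [|[i j]]; first by rewrite /=; lia.
rewrite /=; apply/idP/idP => [ijN|].
  have [/= im jr] := full_lt fN ijN.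
  have [h|[h|[i0 j0]]] : i = 0 \/ j = 0 \/ 0 < i /\ 0 < j by lia.
  - by lia.
  - by lia.
  have /on_border /= : (1, 1) \in N by apply: (cN nw ijN); rewrite /box_le /=; lia.
  by lia.
case/orP => /andP[hi hj].
  by rewrite (eqP hi); apply: (interval_row cN nw corner_ne); lia.
by rewrite (eqP hj); apply: (interval_col cN nw corner_sw); lia.
Qed.

(** If the corner had both neighbours, the box (1, r-2) between them would lie off the border. *)
Lemma one_arm_ne : (0, r - 2) \notin N \/ (1, r.-1) \notin N.
Proof.
case: (boolP ((0, r - 2) \in N)) => h1; [right | by left].
apply/negP => h2; have /on_border /= : (1, r - 2) \in N.
  by apply: (cN h1 h2); rewrite /box_le /=; lia.
by lia.
Qed.

Lemma one_arm_sw : (m - 2, 0) \notin N \/ (m.-1, 1) \notin N.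
Proof.
case: (boolP ((m - 2, 0) \in N)) => h1; [right | by left].
apply/negP => h2; have /on_border /= : (m - 2, 1) \in N.
  by apply: (cN h1 h2); rewrite /box_le /=; lia.
by lia.
Qed.

(** The north-east corner is alone in its column and the south-west corner alone in its row, so
    every box lies in row 0 or in column 0. Since no row or column is empty, both lines are filled
    except at (0, 0). *)
Lemma classify_bi : (0, 0) \notin N -> (1, r.-1) \notin N -> (m.-1, 1) \notin N ->
  N = kind_diagram (m.-1 + r.-1) (Bi m.-1).
Proof.
move=> nw hc hr.
have col i : (i, r.-1) \in N -> i = 0.
  case: i => // i hi; case/negP: hc; apply: (interval_col cN corner_ne hi); lia.
have row j : (m.-1, j) \in N -> j = 0.
  case: j => // j hj; case/negP: hr; apply: (interval_row cN corner_sw hj); lia.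
apply: eq_shape => [|[i j]]; first by rewrite /=; lia.
rewrite /=; apply/idP/idP => [ijN|].
  have [/= im jr] := full_lt fN ijN.
  case/or4P: (on_border ijN) => /= /eqP E; rewrite E in ijN *.
  - by have : j != 0; [apply: contraNneq nw => j0; rewrite j0 in ijN | lia].
  - by rewrite (col _ ijN); lia.
  - by rewrite (row _ ijN); lia.
  by have : i != 0; [apply: contraNneq nw => i0; rewrite i0 in ijN | lia].
case/orP => /andP[hi hj].
  have [u hu] := @full_col _ _ _ fN j ltac:(lia).
  case/or4P: (on_border hu) => /= /eqP E; rewrite E in hu *.
  - by rewrite (eqP hi).
  - by rewrite (eqP hi) -(col _ hu).
  - by have := row _ hu; lia.
  by lia.
have [v hv] := @full_row _ _ _ fN i ltac:(lia).
case/or4P: (on_border hv) => /= /eqP E; rewrite E in hv *.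
- by lia.
- by have := col _ hv; lia.
- by rewrite (eqP hj) corner_sw.
by rewrite (eqP hj).
Qed.

End Convex.

Lemma classification N m r : full N m r -> convex N -> des_free N -> N != fset0 ->
  classified N.
Proof.
move=> fN cN mfN /fset0Pn[x xN].
have [xm xr] := full_lt fN xN.
have m0 : 0 < m by lia. have r0 : 0 < r by lia.
have fA := full_antipode fN; have cA := convex_antipode fN cN.
have mfA := des_free_antipode fN mfN.
have fT := full_transpose fN; have cT := convex_transpose cN.
have mfT := des_free_transpose cN mfN.
have [m1|[m2|m3]] : m = 1 \/ m = 2 \/ 2 < m by lia.
- exact: classify_row fN cN m0 r0 m1.
- exact: classify_two_rows fN cN mfN m0 r0 m2.
have [r1|[r2|r3]] : r = 1 \/ r = 2 \/ 2 < r by lia.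
- exact: (classified_transpose fN (classify_row fT cT r0 m0 r1)).
- exact: (classified_transpose fN (classify_two_rows fT cT mfT r0 m0 r2)).
have hook M : full M m r -> convex M -> des_free M -> (0, 0) \in M -> classified M.
  move=> fM cM mfM nw; exists (m.-1 + r), (Hook m.-1).
  by split; [rewrite /=; lia | left; apply: classify_nw].
have bi M : full M m r -> convex M -> des_free M -> (0, 0) \notin M ->
    (1, r.-1) \notin M -> (m.-1, 1) \notin M -> classified M.
  move=> fM cM mfM nw h1 h2; exists (m.-1 + r.-1), (Bi m.-1).
  by split; [rewrite /=; lia | left; apply: classify_bi].
have mA i j i' j' : i < m -> j < r -> i' = m - i.+1 -> j' = r - j.+1 ->
    ((i', j') \in antipode N) = ((i, j) \in N).
  move=> im jr -> ->; rewrite (mem_antipode fN) /rot_box /=.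
  have -> : m - (m - i.+1).+1 = i by lia. have -> : r - (r - j.+1).+1 = j by lia.
  by have [-> ->] : m - i.+1 < m /\ r - j.+1 < r by split; lia.
have [nw|nw] := boolP ((0, 0) \in N); first exact: hook.
have [se|se] := boolP ((m.-1, r.-1) \in N).
  apply: (classified_antipode fN); apply: hook => //.
  by rewrite (mA m.-1 r.-1) //; lia.
have [h1|h1] := one_arm_ne fN cN mfN m0 r0 m3 r3; have [h2|h2] := one_arm_sw fN cN mfN m0 r0 m3 r3.
- apply: (classified_antipode fN); apply: bi => //.
  + by rewrite (mA m.-1 r.-1) //; lia.
  + by rewrite (mA (m - 2) 0) //; lia.
  by rewrite (mA 0 (r - 2)) //; lia.
(* Mixed arms are impossible. A box of column 1 lies on the border, hence in the first or the last
   row, but neither corner has an arm along its row; the next case is the same with row 1. *)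
- have [i hi] := @full_col _ _ _ fN 1 ltac:(lia).
  case/or4P: (on_border fN cN mfN m0 r0 m3 r3 hi) => /= /eqP E; try lia; rewrite E in hi.
    by case/negP: h1; apply: (interval_row cN hi (corner_ne fN cN m0 r0)); lia.
  by rewrite hi in h2.
- have [j hj] := @full_row _ _ _ fN 1 ltac:(lia).
  case/or4P: (on_border fN cN mfN m0 r0 m3 r3 hj) => /= /eqP E; try lia; rewrite E in hj.
    by rewrite hj in h1.
  by case/negP: h2; apply: (interval_col cN hj (corner_sw fN cN m0 r0)); lia.
exact: bi.
Qed.

(** * Supports of the multiplicity-free shapes *)

Lemma lin_ext_perm (A : diagram) l s : lin_ext A l -> uniq s -> s =i A -> perm_eq l s.
Proof.
move=> [mA oA] us ms; apply: uniq_perm => //; first exact: ordered_uniq.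
by move=> x; rewrite mA ms.
Qed.

Lemma convex_kind n k : valid n k -> convex (kind_diagram n k).
Proof.
move=> vk [x1 x2] [y1 y2] [z1 z2]; rewrite !mem_shape // /box_le.
by case: k vk => [l|l|||k|k] /=; lia.
Qed.

Lemma has_des_transpose A w : convex A ->
  has_des (transpose A) w <-> has_des A (map negb w).
Proof.
move=> cA; split=> [] [l Ll El].
  have Ll' := lin_ext_transpose Ll; rewrite transposeK in Ll'.
  exists (map swap l) => //.
  by rewrite (des_transpose (convex_transpose cA) Ll) El.
exists (map swap l); first exact: lin_ext_transpose.
rewrite (des_transpose cA Ll) El -map_comp -[RHS]map_id.
by apply: eq_map => b /=; rewrite negbK.
Qed.

Definition coll (j a k : nat) : seq (nat * nat) := [seq (i, j) | i <- iota a k].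

Lemma mem_coll j a k (x : nat * nat) : (x \in coll j a k) = (x.2 == j) && (a <= x.1 < a + k).
Proof.
case: x => [u v]; apply/mapP/andP => /= [[i]|[/eqP-> h]].
  by rewrite mem_iota => h [-> ->].
by exists u; rewrite ?mem_iota.
Qed.

Lemma ordered_weave_arms a b k m t :
  0 < a -> 0 < b -> ordered (weave t (rowl 0 a k) (coll 0 b m)).
Proof.
elim: t a b k m => [|[] t IHt] a b k m /= a0 b0.
- by case: (rowl _ _ _).
- case: m => [|m]; first by case: k.
  rewrite /= -/(coll 0 b.+1 m).
  suff : ordered ((b, 0) :: weave t (rowl 0 a k) (coll 0 b.+1 m)) by case: (k).
  rewrite /ordered /= -/(ordered _) IHt // andbT.
  apply/allP => z /mem_weave; rewrite mem_cat mem_rowl mem_coll /box_le /=.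
  by case: z => [u v] /=; lia.
case: k => [|k] //=.
rewrite -/(rowl 0 a.+1 k) /ordered /= -/(ordered _) IHt // andbT.
apply/allP => z /mem_weave; rewrite mem_cat mem_rowl mem_coll /box_le /=.
by case: z => [u v] /=; lia.
Qed.

Lemma uniq_arms a b k m : 0 < b -> uniq (rowl 0 a k ++ coll 0 b m).
Proof.
move=> b0; rewrite cat_uniq !map_inj_uniq ?iota_uniq //; try by move=> ? ? [].
rewrite andbT; apply/hasPn => z; rewrite mem_rowl mem_coll.
by case: z => [u v] /=; lia.
Qed.

(** A step descends exactly when it enters a box of the column: coming from row 0 this is clear, and
    inside the column the order forces the boxes downwards. *)
Lemma des_arms (A : diagram) a k m l :
  (forall x : nat * nat, (x \in A) = (x \in rowl 0 a k ++ coll 0 1 m)) ->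
  lin_ext A l -> des l = behead [seq 0 < z.1 | z <- l].
Proof.
move=> mA [ml]; case: l ml => [|x l] // ml; rewrite /des /=.
have {ml} : all (mem A) (x :: l) by apply/allP => z; rewrite ml.
elim: l x => //= y l IHl x /and3P[xA yA lA].
rewrite {1}/ordered /= -/(ordered _) => /andP[/andP[xy _] ol].
rewrite (IHl y) //=; last by rewrite yA.
congr (_ :: _); move: xA yA xy; rewrite !mA !mem_cat !mem_rowl !mem_coll.
by case: x y {IHl ol} => [x1 x2] [y1 y2]; rewrite /descends /box_le /=; lia.
Qed.

Lemma count_arms (A : diagram) a k m l :
  (forall x : nat * nat, (x \in A) = (x \in rowl 0 a k ++ coll 0 1 m)) ->
  lin_ext A l ->
  count id [seq 0 < z.1 | z <- l] = m /\ size l = k + m.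
Proof.
move=> mA Ll; have pl : perm_eq l (rowl 0 a k ++ coll 0 1 m).
  by apply: lin_ext_perm Ll _ _; [apply: uniq_arms | move=> x; rewrite mA].
rewrite (perm_size pl) size_cat !size_map !size_iota; split=> //.
rewrite count_map (permP pl) count_cat.
rewrite (@eq_in_count _ _ pred0 (rowl _ _ _)) => [|z]; last first.
  by rewrite mem_rowl => /andP[/eqP /= ->].
rewrite count_pred0 (@eq_in_count _ _ predT (coll _ _ _)) => [|z]; last first.
  by rewrite mem_coll /=; lia.
by rewrite count_predT size_map size_iota.
Qed.

Lemma size_count_bool (w : seq bool) : count_mem false w + count id w = size w.
Proof. by elim: w => //= -[] w <-; rewrite /=; lia. Qed.

Lemma count_true (w : seq bool) : count_mem true w = count id w.
Proof. by apply: eq_count => -[]. Qed.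

(** The corner comes first and contributes the letter that [behead] drops; after it the two arms are
    shuffled freely, so all l column boxes are recorded. *)
Lemma has_des_Hook n l w : l < n ->
  has_des (kind_diagram n (Hook l)) w <-> size w = n.-1 /\ count id w = l.
Proof.
move=> ln; have mA (x : nat * nat) : (x \in kind_diagram n (Hook l)) =
    (x \in rowl 0 0 (n - l) ++ coll 0 1 l).
  by rewrite mem_shape //= mem_cat mem_rowl mem_coll; lia.
split=> [[s Ls <-]|[sw cw]].
  have [cs ss] := count_arms mA Ls; rewrite (des_arms mA Ls).
  rewrite size_behead size_map ss; split; first by rewrite subnK // ltnW.
  case: s Ls cs ss => [|x s] [ms os] /=; first by lia.
  have nw : (0, 0) \in x :: s by rewrite ms mem_shape //=; lia.
  suff -> : x = (0, 0) by rewrite add0n.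
  move: nw; rewrite inE => /predU1P[//|nw]; case/andP: os => /allP/(_ _ nw).
  by [].
have [k Ek] : exists k, n - l = k.+1 by exists (n - l.+1); lia.
have /= cf := size_count_bool w.
pose s := (0, 0) :: weave w (rowl 0 1 k) (coll 0 1 l).
have Ls : lin_ext (kind_diagram n (Hook l)) s.
  split=> [x|].
    rewrite mA Ek /= !inE; congr (_ || _); rewrite -/(rowl 0 1 k).
    apply: perm_mem; apply: perm_weave; rewrite size_map size_iota ?count_true //.
    by rewrite /=; lia.
  rewrite /ordered /= -/(ordered _) ordered_weave_arms // andbT.
  apply/allP => z /mem_weave; rewrite mem_cat mem_rowl mem_coll /box_le /=; lia.
exists s => //; rewrite (des_arms mA Ls) /=; apply: map_weave.
- by rewrite size_map size_iota /=; lia.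
- by rewrite size_map size_iota count_true.
- by apply/allP => z; rewrite mem_rowl => /andP[/eqP /= ->].
by apply/allP => z; rewrite mem_coll; lia.
Qed.

(** Either arm may provide the first box, whose letter is dropped: this accounts for the two
    possible numbers of descents and lets every word with such a number occur. *)
Lemma has_des_Bi n l w : 1 <= l <= n - 1 ->
  has_des (kind_diagram n (Bi l)) w <->
  size w = n.-1 /\ (count id w = l \/ count id w = l.-1).
Proof.
move=> hl; have mA (x : nat * nat) : (x \in kind_diagram n (Bi l)) =
    (x \in rowl 0 1 (n - l) ++ coll 0 1 l).
  by rewrite mem_shape //= mem_cat mem_rowl mem_coll; lia.
split=> [[s Ls <-]|[sw cw]].
  have [cs ss] := count_arms mA Ls; rewrite (des_arms mA Ls).
  rewrite size_behead size_map ss; split; first by rewrite subnK //; lia.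
  case: s Ls cs ss => [|x s] _ /=; first by lia.
  by case: (0 < x.1); lia.
have /= cf := size_count_bool w.
have [b Eb] : exists b : bool, b + count id w = l by case: cw => ?; [exists false | exists true]; lia.
have c1 : count_mem false (b :: w) = size (rowl 0 1 (n - l)).
  by rewrite size_map size_iota /=; case: b Eb => /=; lia.
have c2 : count_mem true (b :: w) = size (coll 0 1 l).
  by rewrite size_map size_iota /= count_true; case: (b) Eb => /=; lia.
set s := weave (b :: w) (rowl 0 1 (n - l)) (coll 0 1 l).
have Ls : lin_ext (kind_diagram n (Bi l)) s.
  split=> [x|]; last exact: ordered_weave_arms.
  by rewrite mA; apply: perm_mem; apply: perm_weave.
exists s => //; rewrite (des_arms mA Ls) /s map_weave //.
  by apply/allP => z; rewrite mem_rowl => /andP[/eqP /= ->].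
by apply/allP => z; rewrite mem_coll; lia.
Qed.

(** Two descents that are not adjacent, or one descent that is neither the first nor the last
    letter. The cases correspond to the two boxes of the second row being added separately or
    consecutively. *)
Definition two_word (w : seq bool) : Prop :=
  (exists a b c, w = nseq a false ++ true :: nseq b.+1 false ++ true :: nseq c false) \/
  (exists a b, w = nseq a.+1 false ++ true :: nseq b.+1 false).

Lemma count_id_S (t : seq bool) k : count id t = k.+1 ->
  exists a t', t = nseq a false ++ true :: t' /\ count id t' = k.
Proof.
elim: t => //= -[] t IHt; first by case=> ?; exists 0, t.
by move=> /IHt[a [t' [-> Et']]]; exists a.+1, t'.
Qed.

Lemma count_id_0 (t : seq bool) : count id t = 0 -> t = nseq (size t) false.
Proof. by elim: t => //= -[] // t IHt /IHt <-. Qed.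

Lemma has_des_Two n w : 4 <= n ->
  has_des (kind_diagram n Two) w <-> size w = n.-1 /\ two_word w.
Proof.
move=> n4; have hN : two_rows 0 (n - 2) 2 (kind_diagram n Two).
  by move=> x; rewrite mem_shape //= !mem_rowl; lia.
split=> [[l [ml ol] <-]|[sw]]; last first.
  (* The condition 0 < a + b says that at least two boxes of row 0 precede the second box of row
     1. *)
  have build a b c : a + b + c + 3 = n -> 0 < a + b ->
      has_des (kind_diagram n Two)
        (asc_word (nseq a.+1 false ++ nseq 1 true ++ nseq b false ++ nseq 1 true ++ nseq c false)).
    move=> E ab; exists (weave (nseq a.+1 false ++ nseq 1 true ++ nseq b false ++
        nseq 1 true ++ nseq c false) (rowl 0 0 (n - 2)) (rowl 1 0 2)).
      apply: lin_ext_weave hN _ _ _; try by rewrite !count_cat !count_nseq /=; lia.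
      by rewrite !(ballot_false, ballot_true) //; try lia; rewrite -[nseq c _]cats0 ballot_false.
    by rewrite des_weave // !count_cat !count_nseq /=; lia.
  case=> [[a [b [c Ew]]]|[a [b Ew]]]; move: sw; rewrite Ew; do 3 rewrite /= ?size_cat ?size_nseq; move=> sw.
    have := build a b.+1 c; rewrite /asc_word !pairmap_asc_nseq /=.
    have -> : pairmap (fun a b => ~~ a && b) true (nseq c false) = nseq c false.
      by case: c {build Ew sw} => //= c; elim: c => //= c ->.
    by apply; lia.
  have := build a.+1 0 b; rewrite /asc_word !pairmap_asc_nseq /=.
  have -> : pairmap (fun a b => ~~ a && b) true (nseq b false) = nseq b false.
    by case: b {build Ew sw} => //= b; elim: b => //= b ->.
  by apply; lia.
have lr : all (fun z => z.1 <= 1) l.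
  by apply/allP => z; rewrite ml hN !mem_rowl; lia.
rewrite (des_two_rows lr).
have pl : perm_eq l (rowl 0 0 (n - 2) ++ rowl 1 0 2).
  apply: (@lin_ext_perm (kind_diagram n Two)) => //.
    rewrite cat_uniq !map_inj_uniq ?iota_uniq //; try by move=> ? ? [].
    by rewrite andbT; apply/hasPn => z; rewrite !mem_rowl; lia.
  by move=> x; rewrite mem_cat hN.
have sl : size l = n by rewrite (perm_size pl) size_cat !size_map !size_iota; lia.
set t := [seq _ | _ <- l].
have st : size t = n by rewrite size_map.
have ct : count id t = 2.
  rewrite count_map (permP pl) count_cat.
  rewrite (@eq_in_count _ _ pred0 (rowl _ _ (n - 2))) ?count_pred0 => [|z] //.
  by rewrite mem_rowl => /andP[/eqP /= ->].
split; first by rewrite size_behead size_pairmap st.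
have [a [t1 [Et c1]]] := count_id_S ct; have [b [t2 [Et1 c2]]] := count_id_S c1.
have Et2 := count_id_0 c2; set c := size t2 in Et2.
have nw : (0, 0) \in l by rewrite ml hN !mem_rowl /=; lia.
have [l' El] : exists l', l = (0, 0) :: l'.
  case: l ol nw {ml lr pl sl t st ct Et} => // x l /andP[/allP hx _].
  by rewrite inE => /predU1P[<-|/hx //]; exists l.
case: a Et => [|a] Et; first by move: Et; rewrite /t El.
move: Et; rewrite Et1 Et2 => Et.
case: b {Et1} Et => [|b] Et; last first.
  left; exists a, b, c; rewrite Et.
  rewrite -[true :: nseq c false]/(nseq 1 true ++ nseq c false) -cat1s.
  rewrite -[[:: true]]/(nseq 1 true) /asc_word !pairmap_asc_nseq /=.
  by case: c {Et Et2} => //= c; congr (_ ++ _ :: _ :: _ ++ _ :: _ :: _); elim: c => //= c ->.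
right; case: a Et => [|a] Et.
  (* Here the second and third boxes would both lie in row 1, so (1, 1) would be one of them and
     would precede (0, 1). *)
  case: l' El => [|y [|z l']] El; try by move: Et; rewrite /t El.
  move: Et; rewrite /t El /= => -[y1 z1 _].
  have yl : y \in l by rewrite El !inE eqxx orbT.
  have zl : z \in l by rewrite El !inE eqxx !orbT.
  have yz : y != z by move: (ordered_uniq ol); rewrite El /= !inE => /and4P[_ /norP[]].
  move: ol; rewrite El /ordered /= => /and4P[_ /andP[_ /allP h1] /allP h2 _].
  have : (0, 1) \in l by rewrite ml hN !mem_rowl /=; lia.
  rewrite El !inE /= => /or3P[/eqP E|/eqP E|hl]; try by rewrite -?E in y1 z1.
  have := h1 _ hl; have := h2 _ hl; rewrite /box_le /=.
  move: yl zl yz y1 z1; rewrite !ml !hN !mem_rowl.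
  by case: (y) (z) => [? ?] [? ?]; rewrite xpair_eqE /=; lia.
exists a, c; rewrite Et.
rewrite -[true :: nseq 0 _ ++ _]/(nseq 2 true ++ nseq c false) /asc_word !pairmap_asc_nseq /=.
by congr (_ :: _ ++ _ :: _ :: _); case: c {Et Et2} => //= c; congr (_ :: _); elim: c => //= c ->.
Qed.

(** A computable list of all linear extensions: the first box ranges over the minimal ones, and k,
    the size of s, serves as fuel. It is evaluated on the two sporadic rectangles. *)
Fixpoint lin_exts (k : nat) (s : seq (nat * nat)) : seq (seq (nat * nat)) :=
  if k is k'.+1 then
    flatten [seq [seq x :: l | l <- lin_exts k' (rem x s)]
            | x <- s & all (fun y => (y == x) || ~~ box_le y x) s]
  else [:: [::]].

Lemma mem_lin_exts k s l : uniq s -> size s = k ->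
  (l \in lin_exts k s) = perm_eq l s && ordered l.
Proof.
elim: k s l => [|k IHk] s l us ss.
  by case: s ss us => //= _ _; rewrite inE; case: l => // x l; case: (boolP (perm_eq _ _)) => // /perm_size.
apply/flatten_mapP/andP => /= [[x]|[pl ol]].
  rewrite mem_filter => /andP[/allP hx xs] /mapP[l' hl' ->].
  move: hl'; rewrite IHk ?rem_uniq ?size_rem ?ss // => /andP[pl' ol']; split.
    by rewrite perm_sym (permPl (perm_to_rem xs)) perm_cons perm_sym.
  rewrite /ordered /= -/(ordered _) ol' andbT; apply/allP => y.
  rewrite (perm_mem pl') mem_rem_uniq // inE => /andP[nyx ys].
  by have := hx y ys; rewrite (negPf nyx).
case: l pl ol => [|x l] pl ol; first by move: (perm_size pl); rewrite ss.
have xs : x \in s by rewrite -(perm_mem pl) mem_head.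
have /andP[/allP hx ol'] := ol.
exists x.
  rewrite mem_filter xs andbT; apply/allP => y; rewrite -(perm_mem pl) inE.
  by move=> /predU1P[->|/hx ->]; rewrite ?eqxx ?orbT.
apply/mapP; exists l => //; rewrite IHk ?rem_uniq ?size_rem ?ss //.
apply/andP; split; last exact: ol'.
by rewrite -(perm_cons x) (permPl pl); apply: perm_to_rem.
Qed.

Definition rect_words (k : nat) : seq (seq bool) :=
  [seq des l | l <- lin_exts (2 * k) [seq (i, j) | i <- iota 0 2, j <- iota 0 k]].

Lemma has_des_Rect n k w : valid n (Rect k) ->
  has_des (kind_diagram n (Rect k)) w <-> w \in rect_words k.
Proof.
move=> vk; pose s := [seq (i, j) | i <- iota 0 2, j <- iota 0 k].
have us : uniq s by apply: allpairs_uniq; rewrite ?iota_uniq // => -[? ?] [? ?].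
have ss : size s = 2 * k by rewrite size_allpairs !size_iota.
have ms (x : nat * nat) : (x \in s) = (x \in kind_diagram n (Rect k)).
  rewrite mem_shape //; apply/allpairsP/idP => [[[u v] []]|].
    by rewrite !mem_iota /= => ? ? ->; rewrite /=; lia.
  by case: x => [i j] hx; exists (i, j); split=> //; rewrite mem_iota; move: hx; rewrite /=; lia.
split=> [[l Ll <-]|/mapP[l]]; last first.
  rewrite mem_lin_exts // => /andP[pl ol] ->; exists l => //.
  by split=> // x; rewrite (perm_mem pl) ms.
apply/mapP; exists l => //; rewrite mem_lin_exts //; case: (Ll) => _ ->.
by rewrite andbT; apply: lin_ext_perm Ll us ms.
Qed.

Lemma has_des_dual n k w : valid n k ->
  has_des (kind_diagram n (dual n k)) w <-> has_des (kind_diagram n k) (map negb w).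
Proof.
by move=> vk; rewrite -transpose_shape //; apply: has_des_transpose; apply: convex_kind.
Qed.

(** * Comparison of supports *)

(** All descents come before all ascents; [rising], its complement-wise image, plays the same part
    for transposed shapes. *)
Definition falling (w : seq bool) : bool := pairwise (fun x y => y ==> x) w.
Definition rising (w : seq bool) : bool := pairwise implb w.

Lemma falling_negb w : falling w = rising (map negb w).
Proof.
by rewrite /rising pairwise_map; apply: eq_pairwise => -[] [].
Qed.

Lemma falling_nseq l m : falling (nseq l true ++ nseq m false).
Proof.
rewrite /falling pairwise_cat; apply/and3P; split.
- by apply/allrelP => x y /nseqP[-> _] /nseqP[-> _].
- by elim: l => //= l ->; rewrite andbT; apply/allP => -[].
by elim: m => //= m ->; rewrite andbT; apply/allP => x /nseqP[->].
Qed.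

Lemma pairwise_mid (T : Type) (r : rel T) s x t : pairwise r (s ++ x :: t) -> all (r x) t.
Proof. by rewrite pairwise_cat /= => /and3P[_ _ /andP[]]. Qed.

Lemma two_word_monotone w : two_word w -> ~~ falling w /\ ~~ rising w.
Proof.
case=> [[a [b [c ->]]]|[a [b ->]]]; split; apply/negP.
- by rewrite -cat_rcons => h; have := pairwise_mid h; rewrite all_cat /= andbF.
- by move=> h; have := pairwise_mid h.
- by move=> h; have := @pairwise_mid _ _ [::] _ _ h; rewrite all_cat /= andbF.
by move=> h; have := pairwise_mid h.
Qed.

(** The last item is a word of (n-2,2) with n = 2k. In a two-row rectangle a single descent in
    second position would require the sequence 0 0 1^k 0^(k-2), which is not ballot for k >= 3. *)
Lemma rect_words_facts k : (k == 3) || (k == 4) ->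
  [/\ all (fun w => ~~ falling w && ~~ rising w) (rect_words k),
      all (fun w => rev w \in rect_words k) (rect_words k),
      all (fun w => count id w <= k) (rect_words k),
      all (fun c => has (fun w => count id w == c) (rect_words k)) [:: 1; 2; 3] &
      [:: false, true & nseq (2 * k - 3) false] \notin rect_words k].
Proof. by case/orP=> /eqP->; vm_compute; split. Qed.

Lemma count_negb (w : seq bool) : count id (map negb w) = size w - count id w.
Proof.
by have /= := size_count_bool w; rewrite count_map => <-;
  rewrite addnK; apply: eq_count => -[].
Qed.

Lemma map_negbK (w : seq bool) : map negb (map negb w) = w.
Proof. by rewrite -map_comp -[RHS]map_id; apply: eq_map => b /=; rewrite negbK. Qed.

Lemma has_des_TwoT n w : 4 <= n ->
  has_des (kind_diagram n TwoT) w <-> size w = n.-1 /\ two_word (map negb w).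
Proof.
move=> n4; rewrite -[TwoT]/(dual n Two) has_des_dual // has_des_Two //.
by rewrite size_map.
Qed.

Lemma has_des_RectT n k w : valid n (RectT k) ->
  has_des (kind_diagram n (RectT k)) w <-> map negb w \in rect_words k.
Proof.
by move=> vk; rewrite -[RectT k]/(dual n (Rect k)) has_des_dual // has_des_Rect.
Qed.

Definition arms (k : kind) : bool :=
  match k with Hook _ | Bi _ => true | _ => false end.

Lemma arms_falling n k : valid n k -> arms k ->
  exists2 w, has_des (kind_diagram n k) w & falling w.
Proof.
move=> vk ak; have [l [ln El]] : exists l, l < n /\ (k = Hook l \/ k = Bi l).
  by case: k vk ak => //= l hl _; exists l; split; [lia | by [left | right] | lia | by [left | right]].
exists (nseq l true ++ nseq (n.-1 - l) false); last exact: falling_nseq.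
have [s c] : size (nseq l true ++ nseq (n.-1 - l) false) = n.-1 /\
    count id (nseq l true ++ nseq (n.-1 - l) false) = l.
  by rewrite size_cat !size_nseq count_cat !count_nseq /=; lia.
case: El vk => -> vk; first by apply/has_des_Hook.
by apply/has_des_Bi => //; split=> //; left.
Qed.

Lemma not_arms_falling n k w : valid n k -> ~~ arms k ->
  has_des (kind_diagram n k) w -> ~~ falling w.
Proof.
case: k => // [||k|k] vk _.
- by move/(has_des_Two _ vk)=> [_ /two_word_monotone[]].
- by move/(has_des_TwoT _ vk)=> [_ /two_word_monotone[_]]; rewrite falling_negb.
- move/(has_des_Rect _ vk); case/andP: vk => _ /rect_words_facts[/allP h _ _ _ _].
  by move/h => /andP[].
move/(has_des_RectT _ vk); case/andP: vk => _ /rect_words_facts[/allP h _ _ _ _].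
by move/h => /andP[_]; rewrite falling_negb.
Qed.

Definition has_count (n : nat) (k : kind) (c : nat) : Prop :=
  exists2 w, has_des (kind_diagram n k) w & count id w = c.

Lemma has_count_Hook n l c : valid n (Hook l) -> has_count n (Hook l) c -> c = l.
Proof. by move=> vk [w /(has_des_Hook _ vk)[_ <-]]. Qed.

Lemma has_count_Bi n l c : valid n (Bi l) ->
  has_count n (Bi l) c <-> c = l \/ c = l.-1.
Proof.
move=> vk; split=> [[w /(has_des_Bi _ vk)[_ +] <-] //|hc].
have cn : c <= n.-1 by move: vk hc; rewrite /=; lia.
exists (nseq c true ++ nseq (n.-1 - c) false).
  apply/has_des_Bi => //.
  by rewrite size_cat !size_nseq count_cat !count_nseq /= mul1n addn0 subnKC.
by rewrite count_cat !count_nseq /= mul1n addn0.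
Qed.

Lemma two_word_count w : two_word w -> count id w = 1 \/ count id w = 2.
Proof.
by case=> [[a [b [c ->]]]|[a [b ->]]]; [right | left];
  do 3 rewrite ?count_cat ?count_nseq /=; lia.
Qed.

Lemma has_count_Two n c : 4 <= n -> has_count n Two c <-> c = 1 \/ c = 2.
Proof.
move=> n4; split=> [[w /(has_des_Two _ n4)[_ /two_word_count] + <-] //|hc].
suff [w [sw tw cw]] : exists w, [/\ size w = n.-1, two_word w & count id w = c].
  by exists w => //; apply/has_des_Two.
case: hc => ->.
  exists (nseq 1 false ++ true :: nseq (n - 4).+1 false); split.
  - by rewrite /= size_nseq; lia.
  - by right; exists 0, (n - 4).
  by rewrite /= count_nseq.
exists (nseq 0 false ++ true :: nseq 1 false ++ true :: nseq (n - 4) false); split.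
- by rewrite /= size_nseq; lia.
- by left; exists 0, 0, (n - 4).
by rewrite /= count_nseq.
Qed.

Lemma has_count_dual n k c : valid n k -> c <= n.-1 ->
  (forall w, has_des (kind_diagram n k) w -> size w = n.-1) ->
  has_count n (dual n k) c <-> has_count n k (n.-1 - c).
Proof.
move=> vk cn sk; split=> [[w /(has_des_dual _ vk) hw cw]|[w hw cw]].
  exists (map negb w) => //; rewrite count_negb cw; congr (_ - _).
  by rewrite -(sk _ hw) size_map.
exists (map negb w); first by rewrite has_des_dual // map_negbK.
by rewrite count_negb cw (sk _ hw); lia.
Qed.

Lemma size_has_des n k w : valid n k -> has_des (kind_diagram n k) w ->
  size w = n.-1.
Proof.
have sR j : (j == 3) || (j == 4) -> all (fun w => size w == (2 * j).-1) (rect_words j).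
  by case/orP=> /eqP->; vm_compute.
case: k => [l|l|||k|k] vk.
- by case/(has_des_Hook _ vk).
- by case/(has_des_Bi _ vk).
- by case/(has_des_Two _ vk).
- by case/(has_des_TwoT _ vk).
- by move/(has_des_Rect _ vk); case/andP: vk => /eqP-> /sR/allP h /h/eqP.
move/(has_des_RectT _ vk); case/andP: vk => /eqP-> /sR/allP h /h/eqP.
by rewrite size_map.
Qed.

Lemma has_count_TwoT n c : 4 <= n -> has_count n TwoT c <-> c = n - 2 \/ c = n - 3.
Proof.
move=> n4; have le w : has_des (kind_diagram n TwoT) w -> count id w <= n.-1.
  by move=> hw; rewrite -(@size_has_des n TwoT w n4 hw) count_size.
have [cn|cn] := leqP c n.-1; last first.
  by split=> [[w /le + cw]|]; [rewrite cw|]; lia.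
rewrite -[TwoT]/(dual n Two) has_count_dual //; last by move=> w; apply: (@size_has_des n Two).
by rewrite has_count_Two //; lia.
Qed.

Lemma has_count_Rect n k : valid n (Rect k) ->
  [/\ has_count n (Rect k) 1, has_count n (Rect k) 2, has_count n (Rect k) 3
    & forall c, has_count n (Rect k) c -> c <= k].
Proof.
move=> vk; have := vk; case/andP=> _ /rect_words_facts[_ _ /allP hle /allP hc _].
have h c : c \in [:: 1; 2; 3] -> has_count n (Rect k) c.
  by move/hc => /hasP[w hw /eqP cw]; exists w => //; apply/has_des_Rect.
split; try by apply: h.
by move=> c [w /(has_des_Rect _ vk)/hle + <-].
Qed.

Lemma has_count_RectT n k : valid n (RectT k) ->
  [/\ has_count n (RectT k) (n - 2), has_count n (RectT k) (n - 3),
      has_count n (RectT k) (n - 4)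
    & forall c, has_count n (RectT k) c -> n.-1 - k <= c].
Proof.
move=> vk; have [h1 h2 h3 hle] := @has_count_Rect n k vk.
have hs w : has_des (kind_diagram n (Rect k)) w -> size w = n.-1 by apply: size_has_des.
have n6 : 6 <= n by case/andP: vk; lia.
have hd c : c <= n.-1 -> has_count n (RectT k) c <-> has_count n (Rect k) (n.-1 - c).
  by move=> cn; apply: (@has_count_dual n (Rect k)).
split; try by [rewrite hd; [rewrite (_ : _ - _ = 1) //; lia | lia]
  | rewrite hd; [rewrite (_ : _ - _ = 2) //; lia | lia]
  | rewrite hd; [rewrite (_ : _ - _ = 3) //; lia | lia]].
move=> c; have [cn|cn] := leqP c n.-1; last by lia.
by rewrite hd // => /hle; lia.
Qed.

(** The conditions (a), (b) and (c) of the theorem, expressed on kinds. *)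
Definition contained (n : nat) (kA kB : kind) : Prop :=
  exists l, kA = Bi l /\
    [\/ kB = Hook l \/ kB = Hook l.-1, l = 2 /\ kB = Two | l = n - 2 /\ kB = TwoT].

Lemma contained_has_des n kA kB w : valid n kA -> valid n kB -> contained n kA kB ->
  has_des (kind_diagram n kB) w -> has_des (kind_diagram n kA) w.
Proof.
move=> vA vB [l [EA h]] hw; subst kA; apply/has_des_Bi => //.
split; first exact: size_has_des vB hw.
have : has_count n kB (count id w) by exists w.
case: h vB {hw} => [[]->|[-> ->]|[-> ->]] vB.
- by move/(has_count_Hook vB); left.
- by move/(has_count_Hook vB); right.
- by rewrite has_count_Two //; lia.
by rewrite has_count_TwoT //; lia.
Qed.

(** A rectangle with two rows of length k has at most k descents, which excludes [TwoT] and [RectT],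
    both of which reach n - 2. The descent numbers of [Two] do fit, so there an explicit missing
    word is needed. *)
Lemma compare_Rect n k kB : valid n (Rect k) -> valid n kB -> ~~ arms kB ->
  (forall w, has_des (kind_diagram n kB) w -> has_des (kind_diagram n (Rect k)) w) ->
  kB = Rect k.
Proof.
move=> vA vB aB incl; have [_ _ _ hle] := has_count_Rect vA.
have cincl c : has_count n kB c -> c <= k.
  by move=> [w /incl hw cw]; apply: hle; exists w.
have [/eqP En hk] := andP vA.
case: kB vB aB incl cincl => // [||j|j] vB _ incl cincl.
- have [_ _ _ _ /negP[]] := rect_words_facts hk.
  apply/(has_des_Rect _ vA); apply: incl; apply/has_des_Two => //.
  split; first by rewrite /= size_nseq; lia.
  right; exists 0, (2 * k - 4); have -> : 2 * k - 3 = (2 * k - 4).+1 by move: hk; lia.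
  by [].
- have /cincl : has_count n TwoT (n - 2) by apply/has_count_TwoT => //; left.
  by lia.
- by congr Rect; case/andP: vB; lia.
have [/cincl + _ _ _] := has_count_RectT vB.
by lia.
Qed.

(** Falling words show that only a shape with two arms can contain one with two arms; descent
    numbers settle nearly everything else. Diagrams rather than kinds are equated because distinct
    kinds may give the same diagram. *)
Lemma compare_kinds n kA kB : valid n kA -> valid n kB ->
  (forall w, has_des (kind_diagram n kB) w -> has_des (kind_diagram n kA) w) ->
  kind_diagram n kA = kind_diagram n kB \/ contained n kA kB.
Proof.
move=> vA vB incl; have cincl c : has_count n kB c -> has_count n kA c.
  by move=> [w /incl hw cw]; exists w.
have aAB : arms kB -> arms kA.
  move=> aB; apply: contraT => aA; have [w /incl hw fw] := arms_falling vB aB.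
  by move: (not_arms_falling vA aA hw); rewrite fw.
case: kA vA incl cincl aAB => [l|l|||k|k] vA incl cincl aAB.
- left; congr kind_diagram; have H c : has_count n kB c -> c = l.
    by move=> /cincl /(has_count_Hook vA).
  case: kB vB incl cincl aAB H => [j|j|||j|j] vB _ _ _ H.
  + congr Hook; symmetry; apply: H.
    exists (nseq j true ++ nseq (n.-1 - j) false).
      by apply/has_des_Hook => //; rewrite size_cat !size_nseq count_cat !count_nseq /=;
        move: vB; rewrite /=; lia.
    by rewrite count_cat !count_nseq /=; lia.
  + have h1 := H j; have h2 := H j.-1; rewrite !has_count_Bi // in h1 h2.
    by move: vB => /=; have := h1 (or_introl erefl); have := h2 (or_intror erefl); lia.
  + have h1 := H 1; have h2 := H 2; rewrite !has_count_Two // in h1 h2.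
    by have := h1 (or_introl erefl); have := h2 (or_intror erefl); lia.
  + have h1 := H (n - 2); have h2 := H (n - 3); rewrite !has_count_TwoT // in h1 h2.
    by move: vB => /=; have := h1 (or_introl erefl); have := h2 (or_intror erefl); lia.
  + by have [/H + /H + _ _] := has_count_Rect vB; lia.
  have [/H + /H + _ _] := has_count_RectT vB; case/andP: vB; lia.
- have H c : has_count n kB c -> c = l \/ c = l.-1 by move=> /cincl/(has_count_Bi _ vA).
  case: kB vB incl cincl aAB H => [j|j|||j|j] vB _ _ _ H.
  + have /H h : has_count n (Hook j) j.
      exists (nseq j true ++ nseq (n.-1 - j) false).
        by apply/has_des_Hook => //; rewrite size_cat !size_nseq count_cat !count_nseq /=;
          move: vB; rewrite /=; lia.
      by rewrite count_cat !count_nseq /=; lia.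
    right; exists l; split=> //; constructor 1.
    by case: h => ->; [left | right].
  + left; congr (kind_diagram _ (Bi _)).
    have h1 := H j; have h2 := H j.-1; rewrite !has_count_Bi // in h1 h2.
    by move: vA vB => /=; have := h1 (or_introl erefl); have := h2 (or_intror erefl); lia.
  + right; exists l; split=> //; constructor 2; split=> //.
    have h1 := H 1; have h2 := H 2; rewrite !has_count_Two // in h1 h2.
    by have := h1 (or_introl erefl); have := h2 (or_intror erefl); lia.
  + right; exists l; split=> //; constructor 3; split=> //.
    have h1 := H (n - 2); have h2 := H (n - 3); rewrite !has_count_TwoT // in h1 h2.
    by move: vB => /=; have := h1 (or_introl erefl); have := h2 (or_intror erefl); lia.
  + by have [/H + /H + /H + _] := has_count_Rect vB; lia.
  have [/H + /H + /H + _] := has_count_RectT vB; case/andP: vB; lia.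
- left; have {}aB : ~~ arms kB by apply/negP => /aAB.
  have H c : has_count n kB c -> c = 1 \/ c = 2 by move=> /cincl; rewrite has_count_Two.
  case: kB vB aB incl cincl aAB H => // [|j|j] vB _ _ _ _ H.
  + have h1 := H (n - 2); have h2 := H (n - 3); rewrite !has_count_TwoT // in h1 h2.
    (* Both n-2 and n-3 belong to {1, 2} only for n = 4, where the two diagrams are the same
       square. *)
    have -> : n = 4; last by [].
    by move: vB => /=; have := h1 (or_introl erefl); have := h2 (or_intror erefl); lia.
  + by have [_ _ /H + _] := has_count_Rect vB; lia.
  by have [/H + _ _ _] := has_count_RectT vB; case/andP: vB; lia.
- left; have {}aB : ~~ arms kB by apply/negP => /aAB.
  have H c : has_count n kB c -> c = n - 2 \/ c = n - 3 by move=> /cincl; rewrite has_count_TwoT.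
  case: kB vB aB incl cincl aAB H => // [|j|j] vB _ _ _ _ H.
  + have h1 := H 1; have h2 := H 2; rewrite !has_count_Two // in h1 h2.
    have -> : n = 4; last by [].
    by move: vB => /=; have := h1 (or_introl erefl); have := h2 (or_intror erefl); lia.
  + by have [/H + _ _ _] := has_count_Rect vB; case/andP: vB; lia.
  have [_ _ /H + _] := has_count_RectT vB; case/andP: vB; lia.
- left; congr kind_diagram; symmetry; apply: compare_Rect incl => //.
  by apply/negP => /aAB.
left; have {}aB : ~~ arms kB by apply/negP => /aAB.
(* Transposing both shapes complements the words and leads back to a rectangle with two rows. *)
suff : dual n kB = Rect k by case: kB {vB incl cincl aAB aB} => // j [->].
apply: (@compare_Rect n) => //.
- exact: valid_dual.
- by case: kB aB {vB incl cincl aAB}.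
move=> w; rewrite has_des_dual // => /incl; rewrite has_des_RectT // map_negbK.
by move=> hw; apply/has_des_Rect.
Qed.

Lemma two_word_rev w : two_word w -> two_word (rev w).
Proof.
have revn k x : rev (nseq k x) = nseq k (x : bool) by elim: k => //= k IHk; rewrite rev_cons IHk -cats1 -[in LHS](nseqD k 1) addn1.
case=> [[a [b [c ->]]]|[a [b ->]]].
  left; exists c, b, a.
  by rewrite rev_cat rev_cons rev_cat rev_cons !revn !cat_rcons -catA.
by right; exists b, a; rewrite rev_cat rev_cons !revn cat_rcons.
Qed.

Lemma has_des_rev n k w : valid n k ->
  has_des (kind_diagram n k) w -> has_des (kind_diagram n k) (rev w).
Proof.
case: k => [l|l|||k|k] vk.
- by rewrite !has_des_Hook // size_rev count_rev.
- by rewrite !has_des_Bi // size_rev count_rev.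
- by rewrite !has_des_Two // size_rev => -[-> /two_word_rev].
- by rewrite !has_des_TwoT // size_rev map_rev => -[-> /two_word_rev].
- rewrite !has_des_Rect //; case/andP: vk => _ /rect_words_facts[_ /allP h _ _ _].
  exact: h.
rewrite !has_des_RectT // map_rev; case/andP: vk => _ /rect_words_facts[_ /allP h _ _ _].
exact: h.
Qed.

Lemma has_des_antipode_kind n k w : valid n k ->
  has_des (antipode (kind_diagram n k)) w <-> has_des (kind_diagram n k) w.
Proof.
move=> vk; have [m [r fk]] := full_shape vk; rewrite (has_des_antipode _ fk).
by split=> /(has_des_rev vk); rewrite ?revK.
Qed.

(** * Deleting empty rows and columns *)

Lemma convex_skew A : is_skew_shape A -> convex A.
Proof.
case=> [la [mu [/andP[_ sla] /andP[_ smu] _ ->]]].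
have dec (s : seq nat) i i' : sorted geq s -> i <= i' -> nth 0 s i' <= nth 0 s i.
  move=> ss ii'; have [lti|lei] := ltnP i' (size s); last by rewrite nth_default.
  have tr : transitive geq by move=> a b c /= h1 h2; apply: leq_trans h2 h1.
  have h := sorted_leq_nth tr (fun x => leqnn x) 0 ss.
  by apply: (h i i' _ lti ii'); apply: leq_ltn_trans lti.
move=> x y z; rewrite !in_fsetD !mem_young => /andP[xmu _] /andP[_ yla].
move=> /andP[xz1 xz2] /andP[zy1 zy2]; apply/andP; split.
  rewrite -leqNgt; rewrite -leqNgt in xmu; apply: leq_trans (dec _ _ _ smu xz1) _.
  exact: leq_trans xmu xz2.
apply: leq_ltn_trans zy2 _; apply: leq_trans yla _; exact: dec.
Qed.

(** The new index of line i once the lines outside s have been deleted. *)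
Definition rank (s : seq nat) (i : nat) : nat := count (fun u => u < i) s.

Lemma card_rank (S : {fset nat}) i : #|` [fset u in S | u < i]| = rank S i.
Proof.
rewrite /rank -size_filter; apply: perm_size; apply: uniq_perm.
- exact: fset_uniq.
- by rewrite filter_uniq // fset_uniq.
by move=> u; rewrite !inE mem_filter andbC.
Qed.

Lemma rank_lt s i j : i \in s -> i < j -> rank s i < rank s j.
Proof.
rewrite /rank; elim: s => //= u s IHs; rewrite inE => /predU1P[<-|iS] ij.
  rewrite ltnn ij add0n add1n ltnS; apply: sub_count => v /= vi.
  exact: ltn_trans ij.
by have := IHs iS ij; case: (ltnP u i); case: (ltnP u j) => /=; lia.
Qed.

Lemma rank_ltE s i j : i \in s -> j \in s -> (rank s i < rank s j) = (i < j).
Proof.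
move=> iS jS; have [|ji] := ltnP i j; first exact: rank_lt.
apply/negbTE; rewrite -leqNgt; move: ji; rewrite leq_eqVlt => /predU1P[->//|].
by move=> /(rank_lt jS)/ltnW.
Qed.

Lemma rank_leE s i j : i \in s -> j \in s -> (rank s i <= rank s j) = (i <= j).
Proof. by move=> iS jS; rewrite leqNgt rank_ltE // -leqNgt. Qed.

Lemma rank_max s i : i \in s -> rank s i < size s.
Proof.
move=> iS; rewrite -(count_predT s) /rank.
elim: s iS => //= u s IHs; rewrite inE => /predU1P[<-|/IHs]; last by case: (u < i) => /=; lia.
by rewrite ltnn add0n add1n ltnS; apply: sub_count.
Qed.

(** The rank is injective on s with values below its size, hence surjective by counting. *)
Lemma rank_surj s v : uniq s -> v < size s -> exists2 i, i \in s & rank s i = v.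
Proof.
move=> us vs; have inj : {in s &, injective (rank s)}.
  move=> i j iS jS E; apply/eqP; rewrite eqn_leq.
  by rewrite -(rank_leE iS jS) -(rank_leE jS iS) E leqnn.
have um : uniq (map (rank s) s) by rewrite map_inj_in_uniq.
have sub : {subset map (rank s) s <= iota 0 (size s)}.
  by move=> w /mapP[i iS ->]; rewrite mem_iota /= rank_max.
have [|_ E] := uniq_min_size um sub; first by rewrite size_iota size_map.
have : v \in map (rank s) s by rewrite E mem_iota.
by case/mapP => i iS ->; exists i.
Qed.

Lemma rank_initial (s : seq nat) m i : uniq s -> (forall u, (u \in s) = (u < m)) ->
  i <= m -> rank s i = i.
Proof.
move=> us hs im; rewrite /rank -size_filter -[RHS](size_iota 0); apply: perm_size.
apply: uniq_perm; rewrite ?filter_uniq ?iota_uniq // => u.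
by rewrite mem_filter hs mem_iota /=; lia.
Qed.

Lemma rank_count s i : uniq s -> i \in s ->
  count (fun u => i < u) s = size s - (rank s i).+1.
Proof.
move=> us iS; have c1 : count (pred1 i) s = 1 by rewrite count_uniq_mem // iS.
suff : rank s i + count (pred1 i) s + count (fun u => i < u) s = size s.
  by rewrite c1 => <-; lia.
rewrite /rank; elim: s {us iS c1} => //= u s <-; case: (ltngtP u i) => /=; lia.
Qed.

Section Compress.
Variable A : diagram.
Hypothesis cA : convex A.

Definition compress_box (x : nat * nat) := (rank (rows A) x.1, rank (cols A) x.2).

Lemma compressE : compress A = [fset compress_box x | x in A].
Proof.
by apply: eq_imfset => // x; rewrite !card_rank.
Qed.

Lemma in_rows (x : nat * nat) : x \in A -> x.1 \in rows A.
Proof. by case: x => i j xA; apply/mem_rows; exists j. Qed.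

Lemma in_cols (x : nat * nat) : x \in A -> x.2 \in cols A.
Proof. by case: x => i j xA; apply/mem_cols; exists i. Qed.

Lemma box_le_compress x y : x \in A -> y \in A ->
  box_le (compress_box x) (compress_box y) = box_le x y.
Proof. by move=> xA yA; rewrite /box_le !rank_leE ?in_rows ?in_cols. Qed.

Lemma descends_compress x y : x \in A -> y \in A ->
  descends (compress_box x) (compress_box y) = descends x y.
Proof. by move=> xA yA; rewrite /descends rank_ltE ?in_rows. Qed.

Lemma compress_box_inj : {in A &, injective compress_box}.
Proof.
by move=> x y xA yA E; apply: box_le_anti; rewrite -box_le_compress // E box_lexx.
Qed.

Lemma mem_compress (x : nat * nat) :
  reflect (exists2 y, y \in A & x = compress_box y) (x \in compress A).
Proof. by rewrite compressE; apply: imfsetP. Qed.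

Lemma full_compress : full (compress A) (size (rows A)) (size (cols A)).
Proof.
split=> i.
  apply/mem_rows/idP => [[j /mem_compress[y yA [-> _]]]|hi].
    by apply: rank_max; apply: in_rows.
  have [u /mem_rows[j uA] <-] := rank_surj (fset_uniq _) hi.
  by exists (rank (cols A) j); apply/mem_compress; exists (u, j).
apply/mem_cols/idP => [[j /mem_compress[y yA [_ ->]]]|hi].
  by apply: rank_max; apply: in_cols.
have [u /mem_cols[j uA] <-] := rank_surj (fset_uniq _) hi.
by exists (rank (rows A) j); apply/mem_compress; exists (j, u).
Qed.

(** A position between two compressed boxes lifts, by surjectivity of the rank, to a nonempty row
    and a nonempty column of A; their crossing lies between the original boxes. *)
Lemma convex_compress : convex (compress A).
Proof.
move=> _ _ [z1 z2] /mem_compress[x xA ->] /mem_compress[y yA ->].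
move=> /andP[/= xz1 xz2] /andP[/= zy1 zy2].
have [|u uR Eu] := @rank_surj (rows A) z1 (fset_uniq _).
  by apply: leq_ltn_trans zy1 (rank_max (in_rows yA)).
have [|v vC Ev] := @rank_surj (cols A) z2 (fset_uniq _).
  by apply: leq_ltn_trans zy2 (rank_max (in_cols yA)).
apply/mem_compress; exists (u, v); last by rewrite /compress_box Eu Ev.
apply: (cA xA yA); rewrite /box_le /=.
  by rewrite -(rank_leE (in_rows xA) uR) -(rank_leE (in_cols xA) vC) Eu Ev xz1.
by rewrite -(rank_leE uR (in_rows yA)) -(rank_leE vC (in_cols yA)) Eu Ev zy1.
Qed.

Lemma des_compress l : {subset l <= A} -> des (map compress_box l) = des l.
Proof.
case: l => // x l; rewrite /des /=.
elim: l x => //= y l IHl x sl; rewrite IHl => [|z zl]; last first.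
  by apply: sl; rewrite inE zl orbT.
by rewrite descends_compress //; apply: sl; rewrite !inE eqxx ?orbT.
Qed.

Lemma lin_ext_compress l : lin_ext A l -> lin_ext (compress A) (map compress_box l).
Proof.
move=> [ml ol]; split=> [x|].
  by apply/mapP/mem_compress => -[y yA ->]; exists y; rewrite // ?ml // -ml.
have sl : {subset l <= A} by move=> x; rewrite ml.
rewrite /ordered pairwise_map; elim: l {ml} sl ol => //= x l IHl sl /andP[/allP h ol].
rewrite IHl // => [|z zl]; last by apply: sl; rewrite inE zl orbT.
rewrite andbT; apply/allP => z zl /=; rewrite box_le_compress ?h //; apply: sl.
  by rewrite inE zl orbT.
exact: mem_head.
Qed.

Lemma lin_ext_uncompress l : lin_ext (compress A) l ->
  exists2 l', lin_ext A l' & l = map compress_box l'.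
Proof.
move=> [ml ol]; have [l' sl' El] : exists2 l', {subset l' <= A} & l = map compress_box l'.
  have sl : {subset l <= compress A} by move=> x; rewrite ml.
  elim: l {ml ol} sl => [|x l IHl] sl; first by exists [::].
  have [z zl|l' sl' ->] := IHl; first by apply: sl; rewrite inE zl orbT.
  have /mem_compress[y yA ->] := sl x (mem_head _ _).
  by exists (y :: l') => // z; rewrite inE => /predU1P[->|/sl'].
exists l' => //; split=> [x|].
  apply/idP/idP => [/sl' //|xA].
  have : compress_box x \in l by rewrite ml; apply/mem_compress; exists x.
  by rewrite El => /mapP[y yl' /compress_box_inj -> //]; apply: sl'.
move: ol; rewrite El /ordered pairwise_map.
elim: l' sl' {El} => //= x l' IHl sl /andP[/allP h ol].
rewrite IHl // => [|z zl]; last by apply: sl; rewrite inE zl orbT.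
rewrite andbT; apply/allP => z zl; have := h z zl; rewrite /= box_le_compress //; apply: sl.
  by rewrite inE zl orbT.
exact: mem_head.
Qed.

Lemma has_des_compress w : has_des (compress A) w <-> has_des A w.
Proof.
split=> [[l /lin_ext_uncompress[l' Ll' ->] El]|[l Ll El]].
  by exists l' => //; rewrite -des_compress // => x; case: Ll' => ->.
exists (map compress_box l); first exact: lin_ext_compress.
by rewrite des_compress // => x; case: Ll => ->.
Qed.

Lemma des_free_compress : des_free A -> des_free (compress A).
Proof.
move=> mfA _ _ /lin_ext_uncompress[l Ll ->] /lin_ext_uncompress[l' Ll' ->].
rewrite !des_compress; [|by move=> x; case: Ll' => ->|by move=> x; case: Ll => ->].
by move/(mfA _ _ Ll Ll') ->.
Qed.

(** In reversed coordinates the rank of a line counts the nonempty lines after it, which is the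
    reversed coordinate of its old rank. *)
Lemma antipode_compress : compress (antipode A) = antipode (compress A).
Proof.
rewrite (antipode_full full_compress).
have hlt (S : {fset nat}) i : i \in S -> i < \max_(u <- S) u.+1.
  by move=> iS; apply: (@leq_bigmax_seq _ _ predT succn).
have rk (S T : {fset nat}) h i : (forall u, u \in S -> u < h) ->
    (forall v, (v \in T) = (v \in [seq h - u.+1 | u <- S])) -> i \in S ->
    rank T (h - i.+1) = size S - (rank S i).+1.
  move=> hS hT iS; rewrite -rank_count ?fset_uniq //.
  have pT : perm_eq T [seq h - u.+1 | u <- S].
    apply: uniq_perm; rewrite ?fset_uniq //.
    rewrite map_inj_in_uniq ?fset_uniq // => u v uS vS.
    by have := hS u uS; have := hS v vS; lia.
  rewrite /rank (permP pT) count_map; apply: eq_in_count => u uS /=.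
  by have := hS u uS; have := hS i iS; lia.
have hR := rk (rows A) (rows (antipode A)) (height A).
have hC := rk (cols A) (cols (antipode A)) (width A).
have E (x : nat * nat) : x \in A ->
    (rank (rows (antipode A)) (height A - x.1.+1),
     rank (cols (antipode A)) (width A - x.2.+1)) =
    rot_box (size (rows A)) (size (cols A)) (compress_box x).
  move=> xA; rewrite /rot_box /=; congr pair.
    apply: hR; [exact: hlt | move=> v | exact: in_rows].
    apply/mem_rows/mapP => [[j /imfsetP[y /= yA [-> _]]]|[u /mem_rows[j uA] ->]].
      by exists y.1; rewrite // in_rows.
    by exists (width A - j.+1); apply/imfsetP; exists (u, j).
  apply: hC; [exact: hlt | move=> v | exact: in_cols].
  apply/mem_cols/mapP => [[j /imfsetP[y /= yA [_ ->]]]|[u /mem_cols[j uA] ->]].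
    by exists y.2; rewrite // in_cols.
  by exists (height A - j.+1); apply/imfsetP; exists (j, u).
apply/fsetP => z; apply/imfsetP/imfsetP => /= -[x].
  case/imfsetP => y /= yA -> ->; exists (compress_box y); last by rewrite !card_rank E.
  by apply/mem_compress; exists y.
case/mem_compress => y yA -> ->; exists (height A - y.1.+1, width A - y.2.+1).
  by apply/imfsetP; exists y.
by rewrite !card_rank E.
Qed.

End Compress.

Lemma compress_id N m r : full N m r -> compress N = N.
Proof.
move=> fN; have E (x : nat * nat) : x \in N -> compress_box N x = x.
  move=> xN; have [xm xr] := full_lt fN xN; case: fN => h1 h2.
  rewrite /compress_box (rank_initial _ h1) ?(rank_initial _ h2) ?fset_uniq 1?ltnW //.
  by case: (x).
apply/fsetP => x; apply/mem_compress/idP => [[y yN ->]|xN]; first by rewrite E.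
by exists x; rewrite ?E.
Qed.

Lemma compress_kind n k : valid n k -> compress (kind_diagram n k) = kind_diagram n k.
Proof. by case/full_shape=> m [r /compress_id]. Qed.

Lemma lin_ext_size (A : diagram) l : lin_ext A l -> size l = #|` A|.
Proof.
by move=> Ll; apply: perm_size; apply: lin_ext_perm Ll (fset_uniq _) _.
Qed.

(** The size is read off from the descent words, known to have length n - 1; a box of the diagram
    excludes the ambiguity at size 0. *)
Lemma card_kind n k : valid n k -> #|` kind_diagram n k| = n.
Proof.
move=> vk; have [s ps os] := ordered_exists (fset_uniq (kind_diagram n k)).
have Ls : lin_ext (kind_diagram n k) s by split=> // x; rewrite (perm_mem ps).
have := size_has_des vk (ex_intro2 _ _ s Ls erefl); rewrite size_des (lin_ext_size Ls).
have : #|` kind_diagram n k| != 0.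
  rewrite cardfs_eq0; apply/fset0Pn; exists (if k is Bi _ then (0, 1) else (0, 0)).
  by rewrite mem_shape //; case: k vk {s ps os Ls} => /=; lia.
have n0 : 0 < n by case: k vk {s ps os Ls} => /=; lia.
by lia.
Qed.

Lemma card_antipode A m r : full A m r -> #|` antipode A| = #|` A|.
Proof.
move=> fA; rewrite (antipode_full fA) card_in_imfset // => x y xA yA.
have [? ?] := full_lt fA xA; have [? ?] := full_lt fA yA.
by move=> /(congr1 (rot_box m r)); rewrite !rot_boxK.
Qed.

(** * Uniqueness of F-expansions *)

Lemma sumn_take_lt a i j : is_composition a -> i < size a -> i < j ->
  sumn (take i a) < sumn (take j a).
Proof.
elim: a i j => //= x a IHa [|i] [|j] //= /andP[x0 pa] ia ij.
  by rewrite addn_gt0 x0.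
by rewrite ltn_add2l IHa.
Qed.

Lemma sorted_comp_set a : is_composition a -> sorted ltn (comp_set a).
Proof.
move=> pa; rewrite /comp_set; case: a pa => // x a pa.
apply: (@homo_sorted_in _ _ (fun i => i < size (x :: a)) _ ltn ltn).
- by move=> i j /= ia ja ij; apply: sumn_take_lt.
- by apply/allP => i; rewrite mem_iota /=; lia.
exact: iota_ltn_sorted.
Qed.

Lemma comp_set_inj a b : is_composition a -> is_composition b ->
  sumn a = sumn b -> comp_set a = comp_set b -> a = b.
Proof.
move=> pa pb sab E.
have sz : (size a).-1 = (size b).-1.
  by have := congr1 size E; rewrite !size_map !size_iota.
have {}sz : size a = size b.
  case: a b pa pb sab sz {E} => [|x a] [|y b] //=; last by move=> _ _ _ ->.
    by move=> _ /andP[y0 _] h; lia.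
  by move=> /andP[x0 _] _ h; lia.
have T i : i <= size a -> sumn (take i a) = sumn (take i b).
  case: i => [|i]; first by rewrite !take0.
  rewrite leq_eqVlt => /predU1P[ia|ia].
    by rewrite ia take_size sz take_size.
  have := congr1 (fun s => nth 0 s i) E; rewrite /comp_set.
  by rewrite !(nth_map 0) ?size_iota -?sz ?nth_iota ?add1n //; lia.
apply: (@eq_from_nth _ 0) => // i ia.
have := T i.+1 ia; rewrite (take_nth 0) // (take_nth 0) -?sz // !sumn_rcons.
by rewrite T 1?ltnW //; lia.
Qed.

(** A monomial lies in a single M_b, and b is listed at most once among the compositions; so
    evaluating F_a tests whether b refines a. *)
Lemma qsym_FE (a b : seq nat) m : exponents m = b ->
  qsym_F a m = ((b \in compositions (sumn a)) && all (mem (comp_set b)) (comp_set a))%:R%R.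
Proof.
move=> Em; rewrite /qsym_F /qsym_M Em big_mkcond /=.
have [bin|bin] := boolP (b \in compositions (sumn a)); last first.
  rewrite big_seq big1 // => c cin; case: ifP => // _.
  by case: eqP bin => // ->; rewrite cin.
rewrite (bigD1_seq b) ?uniq_compositions //= eqxx big1 ?addr0 => [|c /negPf nc].
  by case: ifP.
by rewrite eq_sym nc; case: ifP.
Qed.

Lemma monomial_exists (b : seq nat) : is_composition b ->
  exists m : monomial, exponents m = b.
Proof.
move=> pb; exists [fsfun i in [fset i in iota 0 (size b)] => nth 0 b i | 0].
apply/eqP/(exponentsP _ pb); exists (iota 0 (size b)).
rewrite size_iota iota_ltn_sorted; split=> // i; rewrite fsfunE !inE mem_iota /=.
case: ltnP => [ib|bi].
  by rewrite -{2}(add0n i) -(nth_iota 0 0 ib) index_uniq ?size_iota ?iota_uniq.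
by rewrite memNindex ?size_iota ?nth_default // mem_iota -leqNgt.
Qed.

(* Evaluating at a monomial with exponents b sees exactly the coefficients of
   the F_a with a coarser than b, so the coefficients are determined by
   induction on the number of parts. *)
Lemma F_expansion_unique f c c' : F_expansion f c -> F_expansion f c' ->
  forall a, c a = c' a.
Proof.
move=> [pc hc] [pc' hc'] b.
have c0 (d : {fsfun seq nat -> int with 0%R}) a :
    all is_composition (finsupp d) -> ~~ is_composition a -> d a = 0%R.
  by move=> /allP hd na; rewrite fsfun_dflt //; apply: contra na; apply: hd.
have [pb|pb] := boolP (is_composition b); last by rewrite !c0.
have [k] := ubnP (size b); elim: k b pb => // k IHk b pb sb.
have [m Em] := monomial_exists pb.
have sumT (d : {fsfun seq nat -> int with 0%R}) (T : {fset seq nat}) :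
    finsupp d `<=` T ->
    (\sum_(a <- finsupp d) d a * qsym_F a m = \sum_(a <- T) d a * qsym_F a m)%R.
  move=> sT; apply: big_fset_incl => // a _ /fsfun_dflt ->; exact: mul0r.
pose T := b |` (finsupp c `|` finsupp c').
have hE : (\sum_(a <- T) (c a - c' a) * qsym_F a m = 0)%R.
  under eq_bigr do rewrite mulrBl.
  rewrite sumrB -!sumT -?hc -?hc' ?subrr //.
    by rewrite /T fsetUA fsubsetUr.
  by rewrite /T fsetUCA fsubsetUl.
move: hE; rewrite (bigD1_seq b) ?fset_uniq /T ?inE ?eqxx //=.
rewrite big1 => [|a ab]; last first.
  rewrite (qsym_FE a Em); case: andP => [[]|_]; last by rewrite mulr0.
  rewrite mem_compositions => /andP[_ /eqP sab] /allP sub.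
  have [pa|pa] := boolP (is_composition a); last by rewrite !c0 ?subrr ?mul0r.
  rewrite IHk ?subrr ?mul0r //; apply: leq_trans (_ : size b <= k); last by rewrite -ltnS.
  have us d : is_composition d -> uniq (comp_set d).
    by move=> /sorted_comp_set; exact: (sorted_uniq ltn_trans ltnn).
  have sz := uniq_leq_size (us a pa) sub; rewrite !size_map !size_iota in sz.
  (* If a had as many parts as b, the inclusion of S(a) in S(b) would be an equality and a would be
     b. *)
  have [//|le] := ltnP (size a) (size b).
  case/eqP: ab; apply: comp_set_inj => //.
  have le' : size (comp_set b) <= size (comp_set a).
    by rewrite !size_map !size_iota -!subn1 leq_sub2r.
  have [_ E] := uniq_min_size (us a pa) sub le'.
  by apply: (irr_sorted_eq ltn_trans ltnn); rewrite ?sorted_comp_set.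
rewrite addr0 (qsym_FE b Em) mem_compositions pb eqxx /=.
have -> : all (mem (comp_set b)) (comp_set b) by apply/allP.
by rewrite mulr1 => /eqP; rewrite subr_eq0 => /eqP.
Qed.

Lemma F_expansion_exists (f : series) (s : seq (seq nat)) (g : seq nat -> int) :
  uniq s -> all is_composition s ->
  (forall m, f m = \sum_(a <- s) g a * qsym_F a m)%R ->
  exists2 c, F_expansion f c & forall a, c a = (if a \in s then g a else 0%R).
Proof.
move=> us ps hf; pose c : {fsfun seq nat -> int with 0%R} :=
  [fsfun a in [fset a in s] => g a | 0%R].
have cE a : c a = (if a \in s then g a else 0%R) by rewrite fsfunE inE.
have sub a : a \in finsupp c -> a \in s.
  by rewrite mem_finsupp cE; case: ifP; rewrite ?eqxx.
exists c => //; split; first by apply/allP => a /sub; apply: (allP ps).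
move=> m; rewrite hf.
have E : perm_eq [fset a in s] s.
  by apply: uniq_perm; rewrite ?fset_uniq // => a; rewrite inE.
rewrite -(perm_big _ E) /=; symmetry.
rewrite (@big_fset_incl _ _ _ _ _ [fset a in s]) => [| |a _ /fsfun_dflt ->]; last 2 first.
- by apply/fsubsetP => a /sub; rewrite inE.
- by rewrite mul0r.
by rewrite !big_seq; apply: eq_bigr => a; rewrite inE cE => ->.
Qed.

(** * Standard Young tableaux as linear extensions *)

(** Descents are numbered from 1 and letters from 0: descent i is recorded by the letter of index i
    - 1. *)
Definition word_set (n : nat) (w : seq bool) : seq nat :=
  [seq i <- iota 1 n.-1 | nth false w i.-1].

Lemma ordered_index l x y : ordered l -> x \in l -> y \in l -> x <> y ->
  box_le x y -> index x l < index y l.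
Proof.
elim: l => //= z l IHl /andP[/allP h ol]; rewrite !inE.
case: (eqVneq z x) => [->|zx] /= xl.
  by case: eqVneq => [->|].
case: (eqVneq z y) => [Ez|zy] /= yl nxy xy; last by rewrite ltnS IHl.
by move: (h x xl); rewrite Ez xy.
Qed.

Section OneDiagram.
Variable A : diagram.

Definition fill (l : seq (nat * nat)) : filling A :=
  [ffun b => inord (index (val b) l).+1].

Lemma fill_val l (b : A) : lin_ext A l -> fill l b = (index (val b) l).+1 :> nat.
Proof.
move=> Ll; rewrite ffunE inordK // -(lin_ext_size Ll) ltnS index_mem.
by case: Ll => -> _; apply: fsvalP.
Qed.

Lemma is_SYT_fill l : lin_ext A l -> is_SYT (fill l).
Proof.
move=> Ll; case: (Ll) => ml ol; have inl (b : A) : fsval b \in l by rewrite ml; apply: fsvalP.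
have inc (b b' : A) : val b <> val b' -> box_le (val b) (val b') -> fill l b < fill l b'.
  by move=> nb hb; rewrite !fill_val // ltnS; apply: ordered_index => //; apply: inl.
apply/and4P; split.
- apply/injectiveP => b b' /(congr1 val); rewrite /= !fill_val // => -[].
  by move=> /(congr1 (nth (0, 0) l)); rewrite !nth_index // => /val_inj.
- by apply/forallP => b; rewrite fill_val.
- apply/'forall_forallP => b b'; apply/implyP => /andP[/eqP e1 e2]; apply: inc.
    by move=> e; rewrite e ltnn in e2.
  by rewrite /box_le e1 leqnn ltnW.
apply/'forall_forallP => b b'; apply/implyP => /andP[/eqP e1 e2]; apply: inc.
  by move=> e; rewrite e ltnn in e2.
by rewrite /box_le e1 leqnn andbT ltnW.
Qed.

(** A tableau is only required to increase along rows and columns. By convexity the corner in the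
    row of b and the column of b' is a box of A, and passing through it gives monotonicity for the
    whole box order. *)
Lemma SYT_increasing (T : filling A) (b b' : A) : convex A -> is_SYT T ->
  val b <> val b' -> box_le (val b) (val b') -> T b < T b'.
Proof.
move=> cA /and4P[_ _ /'forall_forallP hr /'forall_forallP hc] nb hb.
have row (c c' : A) : (val c).1 = (val c').1 -> (val c).2 <= (val c').2 -> T c <= T c'.
  move=> e; rewrite leq_eqVlt => /predU1P[e2|lt2].
    suff -> : c = c' by [].
    apply: val_inj; move: e e2; case: (val c) (val c') => [? ?] [? ?] /= -> ->.
    by [].
  by apply: ltnW; apply: (implyP (hr c c')); rewrite e eqxx.
have col (c c' : A) : (val c).2 = (val c').2 -> (val c).1 <= (val c').1 -> T c <= T c'.
  move=> e; rewrite leq_eqVlt => /predU1P[e2|lt2].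
    suff -> : c = c' by [].
    apply: val_inj; move: e e2; case: (val c) (val c') => [? ?] [? ?] /= -> ->.
    by [].
  by apply: ltnW; apply: (implyP (hc c c')); rewrite e eqxx.
have dA : ((val b).1, (val b').2) \in A.
  apply: (cA (val b) (val b')) (fsvalP b) (fsvalP b') _ _; move: hb; rewrite /box_le /=.
    by case/andP => _ ->; rewrite leqnn.
  by case/andP => -> _ /=.
have := hb; case/andP; rewrite leq_eqVlt => /predU1P[e1|lt1] le2.
  have lt2 : (val b).2 < (val b').2.
    rewrite ltn_neqAle le2 andbT; apply/eqP => e2; apply: nb.
    by move: e1 e2; case: (val b) (val b') => [? ?] [? ?] /= -> ->.
  by apply: (implyP (hr b b')); rewrite e1 eqxx.
apply: (@leq_ltn_trans (T [` dA])); first by apply: row.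
by apply: (implyP (hc [` dA] b')); rewrite /= eqxx.
Qed.

(** The boxes sorted by their entries form a linear extension. The entries are distinct and lie in
    1, ..., n, hence exhaust this interval, so each entry is one more than the position of its
    box. *)
Lemma SYT_fill (T : filling A) : convex A -> is_SYT T ->
  exists2 l, lin_ext A l & T = fill l.
Proof.
move=> cA sT; pose s := sort (relpre (fun b => T b : nat) leq) (enum {: A}).
have memS (b : A) : b \in s by rewrite mem_sort mem_enum.
have us : uniq s by rewrite sort_uniq enum_uniq.
have [/injectiveP injT /forallP T0 _ _] := and4P sT.
have Ts : [seq T b : nat | b <- s] = iota 1 #|` A|.
  have u1 : uniq [seq T b : nat | b <- s].
    by rewrite map_inj_uniq // => b b' /val_inj /injT.
  have sub : {subset [seq T b : nat | b <- s] <= iota 1 #|` A|}.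
    move=> i /mapP[b _ ->]; rewrite mem_iota T0 /= add1n; apply: ltn_ord.
  have [|_ E] := uniq_min_size u1 sub.
    by rewrite size_iota size_map size_sort -cardE -cardfE.
  apply: (@irr_sorted_eq _ ltn ltn_trans ltnn) => //.
    rewrite ltn_sorted_uniq_leq u1 /= sorted_map.
    by apply: sort_sorted => b b'; apply: leq_total.
  exact: iota_ltn_sorted.
have Ll : lin_ext A (map val s).
  split=> [x|].
    apply/mapP/idP => [[b _ ->]|xA]; first exact: fsvalP.
    by exists [` xA].
  rewrite /ordered pairwise_map.
  have : pairwise (relpre (fun b => T b : nat) ltn) s.
    rewrite -pairwise_map Ts -sorted_pairwise ?iota_ltn_sorted //; exact: ltn_trans.
  apply: sub_pairwise => b b' /= lt; apply/negP => hb.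
  have [e|ne] := eqVneq (val b') (val b).
    by rewrite (val_inj e) ltnn in lt.
  have := SYT_increasing cA sT (elimN eqP ne) hb.
  by rewrite ltnNge ltnW.
exists (map val s) => //; apply/ffunP => b; apply: val_inj.
rewrite /= fill_val // index_map; last exact: val_inj.
have -> : index b s = index (T b : nat) [seq T b : nat | b <- s].
  by rewrite (@index_map _ _ (fun b : A => T b : nat)) // => c c' /val_inj /injT.
rewrite Ts; have Tb : (T b : nat) \in iota 1 #|` A|.
  by rewrite -Ts; apply: map_f.
have bn : (T b).-1 < #|` A| by move: Tb; rewrite mem_iota; have := T0 b; lia.
have := T0 b; case E : (T b : nat) bn => [|i] //= bn _.
have -> : i.+1 = nth 0 (iota 1 #|` A|) i by rewrite nth_iota ?add1n.
by rewrite index_uniq ?size_iota ?iota_uniq // nth_iota ?add1n.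
Qed.

Lemma fill_inj l l' : lin_ext A l -> lin_ext A l' -> fill l = fill l' -> l = l'.
Proof.
move=> Ll Ll' E; have [ml ol] := Ll; have [ml' ol'] := Ll'.
have sz : size l = size l' by rewrite (lin_ext_size Ll) (lin_ext_size Ll').
apply: (@eq_from_nth _ (0, 0)) => // i il.
have xA : nth (0, 0) l i \in A by rewrite -ml mem_nth.
have := congr1 (fun T : filling A => T [` xA] : nat) E.
rewrite !fill_val //= index_uniq ?ordered_uniq // => -[Ei].
by rewrite [in RHS]Ei nth_index // ml'.
Qed.

Lemma descent_set_fill l : lin_ext A l ->
  descent_set (fill l) = word_set #|` A| (des l).
Proof.
move=> Ll; have [ml ol] := Ll; have sl := lin_ext_size Ll.
apply: eq_in_filter => i; rewrite mem_iota => hi.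
have i0 : 0 < i by lia. have il : i < size l by lia.
have E : nth false (des l) i.-1 = descends (nth (0, 0) l i.-1) (nth (0, 0) l i).
  case: l {Ll ml ol sl} il => // x l il; case: i i0 il {hi} => // i _ il.
  by rewrite /des /= (nth_pairmap (0, 0)).
rewrite E; apply/existsP/idP => [[b /existsP[b' /and3P[/eqP eb /eqP eb' lt]]]|lt].
  rewrite !fill_val // in eb eb'; move: lt; rewrite /descends.
  have -> : nth (0, 0) l i.-1 = val b by rewrite -eb nth_index // ml; apply: fsvalP.
  by case: eb' => <-; rewrite nth_index // ml; apply: fsvalP.
have h1 : nth (0, 0) l i.-1 \in A.
  by rewrite -ml mem_nth //; apply: leq_ltn_trans (leq_pred i) il.
have h2 : nth (0, 0) l i \in A by rewrite -ml mem_nth.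
exists [` h1]; apply/existsP; exists [` h2].
rewrite !fill_val //= !index_uniq ?ordered_uniq //; last first.
  exact: leq_ltn_trans (leq_pred i) il.
by rewrite eqxx prednK // eqxx.
Qed.

(** The coefficient of F_a in the skew Schur function of A (see [schur_expansion]). *)
Definition coef (a : seq nat) : nat :=
  #|[pred T : filling A | is_SYT T && (descent_comp T == a)]|.

Lemma path_word_set n w : 0 < n -> path ltn 0 (rcons (word_set n w) n).
Proof.
move=> n0; rewrite /word_set.
have : path ltn 0 (rcons (iota 1 n.-1) n).
  rewrite -cats1 cat_path -[path ltn 0 (iota 1 _)]/(sorted ltn (iota 0 n.-1.+1)).
  rewrite iota_ltn_sorted /= andbT; case: n n0 => // n _.
  by have := mem_last 0 (iota 1 n); rewrite inE mem_iota => /predU1P[->|/andP[]].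
move: (iota _ _) => s; apply: subseq_path; first exact: ltn_trans.
by rewrite -!cats1; apply: cat_subseq => //; apply: filter_subseq.
Qed.

Lemma descent_comp_in l : lin_ext A l ->
  descent_comp (fill l) \in compositions #|` A|.
Proof.
move=> Ll; rewrite /descent_comp descent_set_fill //.
have [->|n0] := posnP #|` A|; first by [].
by apply: comp_of_setP; apply: path_word_set.
Qed.

Lemma coef_outside a : convex A -> a \notin compositions #|` A| -> coef a = 0.
Proof.
move=> cA na; apply: eq_card0 => T; rewrite inE; apply/negP => /andP[sT /eqP E].
have [l Ll ET] := SYT_fill cA sT; move: na; rewrite -E ET.
by rewrite descent_comp_in.
Qed.

Lemma schurE m : convex A ->
  schur A m = (\sum_(a <- compositions #|` A|) (coef a)%:Z * qsym_F a m)%R.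
Proof.
move=> cA; rewrite /schur.
transitivity (\sum_(T : filling A | is_SYT T) \sum_(a <- compositions #|` A|)
    (if descent_comp T == a then qsym_F a m else 0))%R.
  apply: eq_bigr => T sT; rewrite (bigD1_seq (descent_comp T)) /= ?eqxx //.
  - by rewrite big1 ?addr0 // => a; rewrite eq_sym => /negPf->.
  - by have [l Ll ->] := SYT_fill cA sT; apply: descent_comp_in.
  exact: uniq_compositions.
rewrite exchange_big; apply: eq_bigr => a _ /=.
rewrite -big_mkcondr /= sumr_const /coef -mulr_natl; congr (_ * _)%R.
by rewrite natz.
Qed.

Lemma schur_expansion : convex A ->
  exists2 c, F_expansion (schur A) c & forall a, c a = (coef a)%:Z%R.
Proof.
move=> cA; have [|c Ec hc] := @F_expansion_exists (schur A) (compositions #|` A|)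
    (fun a => (coef a)%:Z%R) (uniq_compositions _) _ (fun m => schurE m cA).
  by apply/allP => a; rewrite mem_compositions => /andP[].
exists c => // a; rewrite hc; case: ifPn => // na.
by rewrite coef_outside.
Qed.

Lemma coef_gt0 a : convex A ->
  0 < coef a <-> exists2 w, has_des A w & a = comp_of_set #|` A| (word_set #|` A| w).
Proof.
move=> cA; split=> [/card_gt0P[T]|[w [l Ll <-] ->]].
  rewrite inE => /andP[sT /eqP <-]; have [l Ll ->] := SYT_fill cA sT.
  by exists (des l); [exists l | rewrite /descent_comp descent_set_fill].
apply/card_gt0P; exists (fill l); rewrite inE is_SYT_fill //=.
by rewrite /descent_comp descent_set_fill.
Qed.

Lemma mult_free_coef : convex A -> F_multiplicity_free A -> forall a, coef a <= 1.
Proof.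
move=> cA [c Ec hc] a; have [c' Ec' hc'] := schur_expansion cA.
by have := hc a; rewrite (F_expansion_unique Ec Ec') hc'; case: (coef a) => [|[]] // n [].
Qed.

Lemma mult_free_des_free : convex A -> F_multiplicity_free A -> des_free A.
Proof.
move=> cA /(mult_free_coef cA) c1 l l' Ll Ll' E; apply: fill_inj => //.
have := c1 (descent_comp (fill l)) => /card_le1_eqP; apply; rewrite inE is_SYT_fill //=.
by rewrite /descent_comp !descent_set_fill // E.
Qed.

Lemma supp_coef a : convex A -> supp_F A a <-> 0 < coef a.
Proof.
move=> cA; have [c' Ec' hc'] := schur_expansion cA; split=> [[c Ec]|c0].
  by rewrite (F_expansion_unique Ec Ec') hc'.
by exists c' => //; rewrite hc'.
Qed.

End OneDiagram.

Lemma word_set_inj n w w' : size w = n.-1 -> size w' = n.-1 ->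
  word_set n w = word_set n w' -> w = w'.
Proof.
move=> sw sw' E; apply: (@eq_from_nth _ false); rewrite sw // => i hi.
have := congr1 (fun s => i.+1 \in s) E.
by rewrite !mem_filter mem_iota add1n /= ltnS hi !andbT.
Qed.

Lemma comp_word_inj n w w' : size w = n.-1 -> size w' = n.-1 ->
  comp_of_set n (word_set n w) = comp_of_set n (word_set n w') -> w = w'.
Proof.
case: n => [|n] sw sw' E.
  by move: sw sw'; case: w w' {E} => // -[].
apply: (@word_set_inj n.+1) => //.
by rewrite -(comp_of_setK (path_word_set w _)) // E comp_of_setK // path_word_set.
Qed.

Section TwoDiagrams.
Variables (n : nat) (A B : diagram).
Hypotheses (cA : convex A) (cB : convex B).
Hypotheses (sA : #|` A| = n) (sB : #|` B| = n).

Lemma schur_eq_coef : schur A =1 schur B <-> forall a, coef A a = coef B a.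
Proof.
have [c Ec hc] := schur_expansion cA; have [c' Ec' hc'] := schur_expansion cB.
split=> [E a|E m]; last first.
  by rewrite !schurE // sA sB; apply: eq_bigr => a _; rewrite E.
have Ec2 : F_expansion (schur A) c'.
  by case: Ec' => p h; split=> // m; rewrite E.
by have := F_expansion_unique Ec Ec2 a; rewrite hc hc' => -[].
Qed.

Lemma F_positive_coef :
  F_positive (fun m => schur A m - schur B m)%R <-> forall a, coef B a <= coef A a.
Proof.
have [||m|c Ec hc] := @F_expansion_exists (fun m => schur A m - schur B m)%R
    (compositions n) (fun a => (coef A a)%:Z - (coef B a)%:Z)%R.
- exact: uniq_compositions.
- by apply/allP => a; rewrite mem_compositions => /andP[].
- rewrite !schurE // sA sB -sumrB; apply: eq_bigr => a _; by rewrite mulrBl.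
have {}hc a : c a = ((coef A a)%:Z - (coef B a)%:Z)%R.
  by rewrite hc; case: ifPn => // na; rewrite !coef_outside ?subrr // ?sA ?sB.
split=> [[c' Ec' hc'] a|le].
  by have := hc' a; rewrite (F_expansion_unique Ec' Ec) hc; lia.
by exists c => // a; rewrite hc; have := le a; lia.
Qed.

(** Descent words and compositions determine each other only once the size is fixed; this is where
    the common size n is used. *)
Lemma support_has_des :
  (forall a, 0 < coef B a -> 0 < coef A a) <->
  (forall w, has_des B w -> has_des A w).
Proof.
split=> [H w hw|H a].
  have : 0 < coef B (comp_of_set n (word_set n w)).
    by apply/(coef_gt0 _ cB); exists w; rewrite ?sB.
  move=> /H /(coef_gt0 _ cA)[w' hw']; rewrite sA => /comp_word_inj E.
  have sz (C : diagram) v : #|` C| = n -> has_des C v -> size v = n.-1.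
    by move=> <- [l Ll <-]; rewrite size_des (lin_ext_size Ll).
  by rewrite (E (sz _ _ sB hw) (sz _ _ sA hw')).
move=> /(coef_gt0 _ cB)[w /H hw ->]; apply/(coef_gt0 _ cA); exists w => //.
by rewrite sA sB.
Qed.

End TwoDiagrams.

(** * The theorem *)

Definition has_kind (n : nat) (k : kind) (A : diagram) : Prop :=
  compress A = kind_diagram n k \/ compress A = antipode (kind_diagram n k).

Lemma antipode_kindK n k : valid n k ->
  antipode (antipode (kind_diagram n k)) = kind_diagram n k.
Proof. by case/full_shape=> m [r /antipodeK]. Qed.

Lemma has_kind_antipode n k A : valid n k -> has_kind n k A -> has_kind n k (antipode A).
Proof.
move=> vk; rewrite /has_kind antipode_compress => -[->|->]; first by right.
by left; rewrite antipode_kindK.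
Qed.

Lemma kind_exists n A : is_skew_shape A -> #|` A| = n -> 0 < n ->
  F_multiplicity_free A -> exists2 k, valid n k & has_kind n k A.
Proof.
move=> /convex_skew cA sA n0 /(mult_free_des_free cA)/des_free_compress mfA.
have cardN : #|` compress A| = n.
  by rewrite compressE card_in_imfset //; apply: compress_box_inj.
have fN := full_compress A.
have [|n' [k [vk h]]] := classification fN (convex_compress cA) mfA.
  by rewrite -cardfs_eq0 cardN -lt0n.
have En : n' = n.
  rewrite -cardN -(card_kind vk); case: h => <- //.
  exact: card_antipode fN.
rewrite En in vk h; exists k => //; case: h => h; first by left.
by right; rewrite -h (antipodeK fN).
Qed.

Lemma has_des_kind n k A w : valid n k -> has_kind n k A ->
  has_des A w <-> has_des (kind_diagram n k) w.
Proof.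
move=> vk h; rewrite -has_des_compress; case: h => -> //.
exact: has_des_antipode_kind.
Qed.

Lemma has_kind_same n k A B : valid n k -> has_kind n k A -> has_kind n k B ->
  same_shape B A \/ same_shape B (antipode A).
Proof.
rewrite /same_shape antipode_compress => vk [->|->] [->|->]; rewrite ?antipode_kindK //;
by [left | right].
Qed.

Definition cond_abc (n : nat) (A B : diagram) : Prop :=
  [\/ cond_a n A B, cond_b n A B | cond_c n A B].

Lemma cond_contained n A B : cond_abc n A B ->
  exists kA kB, [/\ valid n kA, valid n kB, contained n kA kB,
    compress A = kind_diagram n kA & compress B = kind_diagram n kB].
Proof.
have hook_pred l : 0 < l < n -> young (n - l + 1 :: nseq (l - 1) 1) = kind_diagram n (Hook l.-1).
  by move=> hl; rewrite /kind_diagram subn1; congr (young (_ :: _)); lia.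
rewrite /same_shape; case=> [[l [hl hA hB]]|[n4 hA hB]|[n4 hA hB]].
- have vA : valid n (Bi l) by [].
  have vH j : j <= l -> valid n (Hook j) by rewrite /=; lia.
  exists (Bi l); case: hB => hB; [exists (Hook l) | exists (Hook l.-1)].
    split=> //; [exact: vH | | by rewrite hA (compress_kind vA) | ].
      by exists l; split=> //; constructor 1; left.
    by rewrite hB; apply: (@compress_kind n (Hook l)); apply: vH.
  split=> //; [by apply: vH; lia | | by rewrite hA (compress_kind vA) | ].
    by exists l; split=> //; constructor 1; right.
  by rewrite hB hook_pred ?compress_kind ?vH //; lia.
- have vA : valid n (Bi 2) by rewrite /=; lia.
  have vB : valid n Two by [].
  exists (Bi 2), Two; split=> //; first by exists 2; split=> //; constructor 2.
    by rewrite hA -(compress_kind vA).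
  by rewrite hB -(compress_kind vB).
have vA : valid n (Bi (n - 2)) by rewrite /=; lia.
have vB : valid n TwoT by [].
exists (Bi (n - 2)), TwoT; split=> //; first by exists (n - 2); split=> //; constructor 3.
  rewrite hA -(compress_kind vA) /kind_diagram; congr (compress (dsum _ (young [:: _]))).
  by lia.
by rewrite hB -(compress_kind vB).
Qed.

Lemma contained_cond n kA kB A B : valid n kA -> valid n kB -> contained n kA kB ->
  compress A = kind_diagram n kA -> compress B = kind_diagram n kB -> cond_abc n A B.
Proof.
move=> vA vB [l [EA h]]; subst kA; rewrite -(compress_kind vA) -(compress_kind vB).
have hook_pred : 0 < l < n -> young (n - l + 1 :: nseq (l - 1) 1) = kind_diagram n (Hook l.-1).
  by move=> hl; rewrite /kind_diagram subn1; congr (young (_ :: _)); lia.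
case: h vB => [[]->|[E ->]|[E ->]] vB hA hB.
- by constructor 1; exists l; split=> //; left.
- constructor 1; exists l; split=> //; right; rewrite /same_shape hook_pred //.
  by move: vA; rewrite /=; lia.
- by constructor 2; split=> //; rewrite -E.
constructor 3; split=> //; rewrite /same_shape hA E /kind_diagram.
by congr (compress (dsum _ (young [:: _]))); move: vB; rewrite /=; lia.
Qed.

Lemma has_kind_rotate n k A : valid n k -> has_kind n k A ->
  exists2 A', A' = A \/ A' = antipode A & compress A' = kind_diagram n k.
Proof.
move=> vk [h|h]; first by exists A; [left|].
by exists (antipode A); [right | rewrite antipode_compress h antipode_kindK].
Qed.

Lemma has_kind_unrotate n k A A' : valid n k -> A' = A \/ A' = antipode A ->
  compress A' = kind_diagram n k -> has_kind n k A.
Proof.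
move=> vk [->|->] h; first by left.
by right; rewrite -h antipode_compress (antipodeK (full_compress A)).
Qed.


Theorem theorem6p2 (n : nat) (A B : diagram)
  (skewA : is_skew_shape A) (skewB : is_skew_shape B)
  (sizeA : #|` A|%fset = n) (sizeB : #|` B|%fset = n)
  (mfA : F_multiplicity_free A) (mfB : F_multiplicity_free B) :
  (schur A =1 schur B <-> same_shape B A \/ same_shape B (antipode A)) /\
  (~ (same_shape B A \/ same_shape B (antipode A)) ->
     (F_positive (fun m => schur A m - schur B m)%R <->
        (forall a : seq nat, supp_F B a -> supp_F A a)) /\
     (F_positive (fun m => schur A m - schur B m)%R <->
        exists A' B' : diagram,
          [/\ A' = A \/ A' = antipode A,
              B' = B \/ B' = antipode B &
              [\/ cond_a n A' B', cond_b n A' B' | cond_c n A' B']])).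
Proof.
have cA := convex_skew skewA; have cB := convex_skew skewB.
have cfA := mult_free_coef cA mfA; have cfB := mult_free_coef cB mfB.
(* The classification concerns nonempty diagrams; for n = 0 both diagrams are empty and every claim
   is immediate. *)
have [n0|n_gt0] := posnP n.
  have A0 : A = fset0 by apply/eqP; rewrite -cardfs_eq0 sizeA n0.
  have B0 : B = fset0 by apply/eqP; rewrite -cardfs_eq0 sizeB n0.
  subst A B; split=> [|[]]; last by left.
  by split=> // _; left.
have [kA vA hA] := kind_exists skewA sizeA n_gt0 mfA.
have [kB vB hB] := kind_exists skewB sizeB n_gt0 mfB.
have desA w := has_des_kind w vA hA; have desB w := has_des_kind w vB hB.
(* The coefficients for B are at most 1, so comparing coefficients amounts to comparing supports. *)
have le_supp : (forall a, coef B a <= coef A a) <->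
    (forall w, has_des B w -> has_des A w).
  rewrite -(support_has_des cA cB sizeA sizeB); split=> le a.
    by move=> h; apply: leq_trans (le a).
  by have := cfB a; case: (coef B a) (le a) => [|[|//]] // /(_ isT).
have pos_supp : F_positive (fun m => schur A m - schur B m)%R <->
    (forall w, has_des B w -> has_des A w).
  by rewrite (F_positive_coef cA cB sizeA sizeB).
have compare : (forall w, has_des B w -> has_des A w) ->
    kind_diagram n kA = kind_diagram n kB \/ contained n kA kB.
  by move=> H; apply: compare_kinds => // w /desB /H /desA.
have same_of_eq : kind_diagram n kA = kind_diagram n kB ->
    same_shape B A \/ same_shape B (antipode A).
  by move=> E; apply: (@has_kind_same n kA) => //; rewrite /has_kind E.
split.
  rewrite (schur_eq_coef cA cB sizeA sizeB); split=> [E|same].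
    have HBA : forall w, has_des B w -> has_des A w by apply/le_supp => a; rewrite E.
    have HAB : forall w, has_des A w -> has_des B w.
      by apply/(support_has_des cB cA sizeB sizeA) => a; rewrite E.
    (* Two opposite proper containments cannot coexist: the containing shape is of kind [Bi], the
       contained one never is. *)
    have [/same_of_eq //|[l [El _]]] := compare HBA.
    have [E'|[l' [El' h]]] : kind_diagram n kB = kind_diagram n kA \/ contained n kB kA.
    - by apply: compare_kinds => // w /desA /HAB /desB.
    - by apply: same_of_eq.
    by move: h; rewrite El => -[[]|[]|[]].
  have hB' : has_kind n kA B.
    case: same; rewrite /same_shape /has_kind => ->; first exact: hA.
    exact: has_kind_antipode vA hA.
  have H w : has_des A w <-> has_des B w.
    by rewrite (has_des_kind w vA hB') desA.
  have leBA : forall a, coef B a <= coef A a by apply/le_supp => w /H.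
  move=> a; apply/eqP; rewrite eqn_leq leBA andbT.
  have := @support_has_des n B A cB cA sizeB sizeA.
  case=> _ /(_ (fun w => proj1 (H w)) a).
  by have := cfA a; case: (coef A a) => [|[|//]] // _ /(_ isT).
move=> diff; split.
  rewrite pos_supp -(support_has_des cA cB sizeA sizeB).
  by split=> H a; [move/(supp_coef _ cB)/H/(supp_coef _ cA) |
                   move/(supp_coef _ cB)/H/(supp_coef _ cA)].
rewrite pos_supp; split=> [/compare[/same_of_eq //|cont]|[A' [B' [hA' hB' /cond_contained]]]].
  have [A' hA' EA] := has_kind_rotate vA hA; have [B' hB' EB] := has_kind_rotate vB hB.
  by exists A', B'; split=> //; apply: contained_cond cont EA EB.
move=> [kA' [kB' [vA' vB' cont EA EB]]] w.
have hkA := has_kind_unrotate vA' hA' EA; have hkB := has_kind_unrotate vB' hB' EB.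
rewrite (has_des_kind w vA' hkA) (has_des_kind w vB' hkB).
exact: contained_has_des.
Qed.
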